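(* Let $n\ge 2$ and let $u:\mathbb R^n\to\mathbb R$ be a smooth function with $|Du|<1$, whose graph $\mathcal M_u=\{(x,u(x)):x\in\mathbb R^n\}$ in Minkowski space $\mathbb R^{n,1}$ satisfies the following conditions. Write $x=(x_1,\bar x)$ with $\bar x=(x_2,\dots,x_n)$, $\bar{\mathcal B}_+=\mathbb S^{n-1}\cap\{x_1\ge 0\}$ and $V_{\bar{\mathcal B}_+}(x)=\sup_{\lambda\in\bar{\mathcal B}_+}x\cdot\lambda$. (1) $\sigma_1(\kappa[\mathcal M_u])=n$; (2) $u(x)-V_{\bar{\mathcal B}_+}(x)\to 0$ as $|x|\to\infty$ with $\frac{x}{|x|}\in\bar{\mathcal B}_+$, and also as $x_1\to-\infty$ and $|\bar x|\to\infty$; (3) there is a constant $C_0$ with $|u(x)-V_{\bar{\mathcal B}_+}(x)|\le C_0$ for all $x\in\mathbb R^n$. Then $u$ is the standard semitrough $\mathbf z^1$, i.e. $u(x)=\mathbf z^1(x)$ for all $x\in\mathbb R^n$.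
   Context: $\mathbb R^{n,1}$ is $\mathbb R^{n+1}$ with metric $\sum_{i=1}^n dx_i^2-dx_{n+1}^2$. The principal curvatures $\kappa[\mathcal M_u]$ of a spacelike graph ($|Du|<1$) are the eigenvalues of $(g_{ij})^{-1}(h_{ij})$ with $g_{ij}=\delta_{ij}-u_iu_j$, $h_{ij}=u_{ij}/\sqrt{1-|Du|^2}$; $\sigma_1$ is their sum, so $\sigma_1(\kappa[\mathcal M_u])=\operatorname{div}\big(Du/\sqrt{1-|Du|^2}\big)$. The standard semitrough $\mathbf z^1$ is $\mathbf z^1(x)=\sqrt{f_1(x_1)^2+|\bar x|^2}$, where $f_1:\mathbb R\to\mathbb R$ is the solution of $$\frac{f''}{(1-f'^2)^{3/2}}+\frac{n-1}{f(1-f'^2)^{1/2}}=n$$ with the properties: $0<f_1'<1$ and $f_1''>0$ on $\mathbb R$; $\lim_{t\to-\infty}f_1(t)=\frac{n-1}{n}$; $\max\{\frac{n-1}{n},t\}<f_1(t)<\sqrt{1+t^2}$ for all $t$; and $|f_1(t)-\sqrt{1+t^2}|<Ct^{-n-1}$ for all large $t>0$, for some constant $C$. *)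

(* Defs.v *)
From HB Require Import structures.
From mathcomp Require Import all_boot all_order all_algebra.
From mathcomp Require Import all_classical all_reals all_analysis.

Set Implicit Arguments.
Unset Strict Implicit.
Unset Printing Implicit Defensive.

Import Order.TTheory GRing.Theory Num.Theory.
Import numFieldNormedType.Exports.

Local Open Scope ring_scope.
Local Open Scope classical_set_scope.

(* A point of R^n is a row vector 'rV[R]_n.  The
   library norm on 'rV[R]_n is the sup norm; it is used only for the topology
   and the derivatives, and |x| is always [enorm x]. *)

Section Euclidean.
Context {R : realType}.

Definition dot (n : nat) (x y : 'rV[R]_n) : R := \sum_(i < n) x 0 i * y 0 i.

Definition enorm (n : nat) (x : 'rV[R]_n) : R := Num.sqrt (dot x x).

End Euclidean.

Section Calculus.
Context {R : realType} {n : nat}.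
Implicit Types (u : 'rV[R]_n -> R) (x : 'rV[R]_n).

Definition partial (i : 'I_n) u : 'rV[R]_n -> R :=
  fun x => 'D_(delta_mx 0 i) u x.

Definition iter_partial (s : seq 'I_n) u : 'rV[R]_n -> R := foldr partial u s.

(* C^infinity: all iterated partial derivatives exist and are continuous.
   Existence is required separately because 'D_v is a total operator. *)
Definition smooth u : Prop :=
  forall s : seq 'I_n,
    continuous (iter_partial s u) /\
    forall (i : 'I_n) x, derivable (iter_partial s u) x (delta_mx 0 i).

Definition grad u x : 'rV[R]_n := \row_(i < n) partial i u x.

Definition hessian u x : 'M[R]_n :=
  \matrix_(i < n, j < n) partial j (partial i u) x.

End Calculus.

Section SpacelikeGraph.
Context {R : realType} {n : nat}.
Implicit Types (u : 'rV[R]_n -> R) (x : 'rV[R]_n).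

Definition spacelike u : Prop := forall x, enorm (grad u x) < 1.

Definition first_form u x : 'M[R]_n :=
  \matrix_(i < n, j < n) ((i == j)%:R - grad u x 0 i * grad u x 0 j).

Definition second_form u x : 'M[R]_n :=
  \matrix_(i < n, j < n)
    (hessian u x i j / Num.sqrt (1 - enorm (grad u x) ^+ 2)).

(* [kappa] lists the eigenvalues of g^-1 h, repeated according to their
   multiplicity as roots of the characteristic polynomial; this determines it
   up to a permutation. *)
Definition principal_curvatures u x (kappa : 'rV[R]_n) : Prop :=
  char_poly (invmx (first_form u x) *m second_form u x) =
  \prod_(i < n) ('X - (kappa 0 i)%:P).

Definition sigma1 (kappa : 'rV[R]_n) : R := \sum_(i < n) kappa 0 i.

End SpacelikeGraph.

(* R^n with n = m.+1 and x = (x_1, xbar). *)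
Section Semitrough.
Context {R : realType} {m : nat}.
Implicit Types x lambda : 'rV[R]_m.+1.

Definition x1 x : R := x 0 ord0.

Definition xbar x : 'rV[R]_m := \row_(j < m) x 0 (lift ord0 j).

Definition half_sphere : set 'rV[R]_m.+1 :=
  [set lambda | enorm lambda = 1 /\ 0 <= x1 lambda].

Definition V_half_sphere x : R := sup [set dot x lambda | lambda in half_sphere].

(* The graph of [semitrough f] is the standard semitrough z^1 when [f] is the
   profile f_1. *)
Definition semitrough (f : R -> R) x : R :=
  Num.sqrt (f (x1 x) ^+ 2 + enorm (xbar x) ^+ 2).

End Semitrough.

Section Profile.
Context {R : realType}.

(* [f] is the profile f_1 of the standard semitrough in dimension [n]. *)
Record semitrough_profile (n : nat) (f : R -> R) : Prop := SemitroughProfile {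
  profile_derivable : forall t : R, derivable f t 1;
  profile_derivable2 : forall t : R, derivable (derive1 f) t 1;
  profile_ode : forall t : R,
    derive1n 2 f t / (1 - derive1 f t ^+ 2) `^ (3 / 2)
    + (n%:R - 1) / (f t * (1 - derive1 f t ^+ 2) `^ (1 / 2)) = n%:R;
  profile_deriv_bounds : forall t : R, 0 < derive1 f t < 1;
  profile_convex : forall t : R, 0 < derive1n 2 f t;
  profile_cvg_ninfty : f t @[t --> -oo] --> ((n%:R - 1) / n%:R : R);
  profile_bounds : forall t : R,
    Num.max ((n%:R - 1) / n%:R) t < f t < Num.sqrt (1 + t ^+ 2);
  profile_asymptotics : exists C : R,
    \forall t \near +oo, `|f t - Num.sqrt (1 + t ^+ 2)| < C * t ^- n.+1
}.

End Profile.

(* Main.v *)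
(* Write [V] for [V_half_sphere] and [r] for [enorm (xbar x)].  A function
   [semitrough g x = sqrt (g (x1 x) ^+ 2 + r ^+ 2)] is invariant under
   SO(m, 1), so its mean curvature depends only on [x1 x]; with
   [s = sqrt (1 - g'^2)] it is [g'' / s^3 + m / (g * s)].  Take [f] the profile,
   [gap t = sqrt (1 + t^2) - t], [l = 1 + 16 e] and
   [g t = l * (f (t / l) + e * gap (t / l))].  The dilation by [l] moves the
   mean curvature by a definite amount of order [e], which dominates the effect
   of [e * gap]: [semitrough g] is a strict supersolution for small [e > 0] and,
   where [g > 0], a strict subsolution for small [e < 0].

   As [u] is 1-Lipschitz and asymptotic to [V] along the rays of the half
   sphere, [V <= u] everywhere.  If [e > 0], then [g] grows linearly at [-oo],
   so [u - semitrough g] has no positive supremum at infinity; if [e < 0], then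
   [g] vanishes at a finite point, and the same holds for [semitrough g - u]
   because [r <= V <= u].  A positive maximum would be attained at a contact
   point, where the second derivative test contradicts the strict inequality.
   Letting [e] tend to 0 gives both inequalities between [u] and
   [semitrough f]. *)

Require Import Defs.
From HB Require Import structures.
From mathcomp Require Import all_boot all_order all_algebra.
From mathcomp Require Import all_classical all_reals all_analysis.
From mathcomp Require Import ring lra.

Set Implicit Arguments.
Unset Strict Implicit.
Unset Printing Implicit Defensive.

Import Order.TTheory GRing.Theory Num.Theory.
Import numFieldNormedType.Exports.

Local Open Scope ring_scope.
Local Open Scope classical_set_scope.

(** * Euclidean structure and calculus along lines *)

Section EuclideanTheory.
Context {R : realType}.

Section AnyDimension.
Context {n : nat}.
Implicit Types (x y z d : 'rV[R]_n) (a : R).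

Lemma dotC x y : dot x y = dot y x.
Proof. by apply: eq_bigr => i _; rewrite mulrC. Qed.

Lemma dotDl x y z : dot (x + y) z = dot x z + dot y z.
Proof. by rewrite -big_split; apply: eq_bigr => i _; rewrite mxE mulrDl. Qed.

Lemma dotZl a x y : dot (a *: x) y = a * dot x y.
Proof. by rewrite /dot mulr_sumr; apply: eq_bigr => i _; rewrite mxE mulrA. Qed.

Lemma dotDr x y z : dot x (y + z) = dot x y + dot x z.
Proof. by rewrite dotC dotDl !(dotC x). Qed.

Lemma dotZr a x y : dot x (a *: y) = a * dot x y.
Proof. by rewrite dotC dotZl dotC. Qed.

Lemma dot0r x : dot x 0 = 0.
Proof. by rewrite -(scale0r 0) dotZr mul0r. Qed.

Lemma dotNr x y : dot x (- y) = - dot x y.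
Proof. by rewrite -scaleN1r dotZr mulN1r. Qed.

Lemma dotNl x y : dot (- x) y = - dot x y.
Proof. by rewrite dotC dotNr dotC. Qed.

Lemma dot_delta x i : dot x (delta_mx 0 i) = x 0 i.
Proof.
rewrite /dot (bigD1 i) //= mxE !eqxx mulr1 big1 ?addr0 // => j ji.
by rewrite mxE eqxx /= (negbTE ji) mulr0.
Qed.

Lemma dotxx_ge0 x : 0 <= dot x x.
Proof. by apply: sumr_ge0 => i _; rewrite -expr2 sqr_ge0. Qed.

Lemma enorm_ge0 x : 0 <= enorm x.
Proof. exact: sqrtr_ge0. Qed.

Lemma enorm_sqr x : enorm x ^+ 2 = dot x x.
Proof. by rewrite sqr_sqrtr ?dotxx_ge0. Qed.

Lemma cauchy_schwarz x y : dot x y <= enorm x * enorm y.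
Proof.
have [xy0|xy0] := leP (dot x y) 0.
  by rewrite (le_trans xy0) // mulr_ge0 ?enorm_ge0.
have yy0 : 0 < dot y y.
  rewrite lt_neqAle dotxx_ge0 andbT eq_sym; apply/eqP => /psumr_eq0P y0.
  suff : dot x y = 0 by move=> h; rewrite h ltxx in xy0.
  rewrite /dot big1 // => i _.
  have /eqP := y0 (fun i _ => sqr_ge0 _) i isT.
  by rewrite mulf_eq0 orbb => /eqP->; rewrite mulr0.
rewrite -(@ler_pXn2r _ 2) ?nnegrE ?mulr_ge0 ?enorm_ge0 ?(ltW xy0) //.
rewrite exprMn !enorm_sqr -subr_ge0 -(pmulr_rge0 _ yy0).
(* The squared norm of this vector is [dot y y] times [dot x x * dot y y - dot x y ^+ 2]. *)
have := dotxx_ge0 (dot y y *: x - dot x y *: y).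
rewrite !(dotDl, dotDr, dotNl, dotNr, dotZl, dotZr) (dotC y x).
by congr (0 <= _); ring.
Qed.

Lemma normr_coord_le_enorm x i : `|x 0 i| <= enorm x.
Proof.
rewrite -sqrtr_sqr; apply: ler_wsqrtr.
rewrite /dot (bigD1 i) //= -expr2 lerDl sumr_ge0 // => j _.
by rewrite -expr2 sqr_ge0.
Qed.

Lemma enormZ a x : enorm (a *: x) = `|a| * enorm x.
Proof.
by rewrite /enorm dotZl dotZr mulrA -expr2 sqrtrM ?sqr_ge0 // sqrtr_sqr.
Qed.

Lemma enorm_eq0 x : enorm x = 0 -> x = 0.
Proof.
move=> x0; apply/rowP => i; rewrite mxE; apply/eqP; rewrite -normr_le0 -x0.
exact: normr_coord_le_enorm.
Qed.

Lemma enorm0 : enorm (0 : 'rV[R]_n) = 0.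
Proof. by rewrite /enorm dot0r sqrtr0. Qed.

Lemma enorm_sqrB x y :
  enorm (x - y) ^+ 2 = enorm x ^+ 2 - 2 * dot x y + enorm y ^+ 2.
Proof.
rewrite !enorm_sqr !(dotDl, dotDr, dotNl, dotNr) (dotC y x).
by ring.
Qed.

End AnyDimension.

Section Split.
Context {m : nat}.
Implicit Types (x y : 'rV[R]_m.+1).

Lemma dot_split x y : dot x y = x1 x * x1 y + dot (xbar x) (xbar y).
Proof.
rewrite /dot big_ord_recl; congr (_ + _).
by apply: eq_bigr => i _; rewrite !mxE.
Qed.

Lemma enorm_split x : enorm x ^+ 2 = x1 x ^+ 2 + enorm (xbar x) ^+ 2.
Proof. by rewrite !enorm_sqr dot_split expr2. Qed.

Lemma x1D x y : x1 (x + y) = x1 x + x1 y. Proof. by rewrite /x1 mxE. Qed.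
Lemma x1Z a x : x1 (a *: x) = a * x1 x. Proof. by rewrite /x1 mxE. Qed.

Lemma xbarD x y : xbar (x + y) = xbar x + xbar y.
Proof. by apply/rowP => j; rewrite !mxE. Qed.

Lemma xbarZ a x : xbar (a *: x) = a *: xbar x.
Proof. by apply/rowP => j; rewrite !mxE. Qed.

(** Inverse of the splitting into [x1] and [xbar]: [unlift ord0] is [None] exactly at index 0, where
    [oapp] returns [a]. *)
Definition cons_row (a : R) (b : 'rV[R]_m) : 'rV[R]_m.+1 :=
  \row_(i < m.+1) oapp (b 0) a (unlift ord0 i).

Lemma x1_cons a b : x1 (cons_row a b) = a.
Proof. by rewrite /x1 mxE unlift_none. Qed.

Lemma xbar_cons a b : xbar (cons_row a b) = b.
Proof. by apply/rowP => j; rewrite !mxE liftK. Qed.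

Lemma enorm_xbar_le x : enorm (xbar x) <= enorm x.
Proof.
rewrite -(@ler_pXn2r _ 2) ?nnegrE ?enorm_ge0 // enorm_split lerDr.
exact: sqr_ge0.
Qed.

End Split.
End EuclideanTheory.

(** * Mean value theorem and second derivative test on the line *)

Section LineCalculus.
Context {R : realType}.
Implicit Types (f df : R -> R).

(** Locating [c] by its distance to [a] covers both orders of [a] and [b] at once. *)
Lemma mean_value f df : (forall t, is_derive t (1 : R) f (df t)) ->
  forall a b, exists2 c, `|c - a| <= `|b - a| & f b - f a = df c * (b - a).
Proof.
move=> fd a b.
have fc : continuous f.
  move=> t; apply: differentiable_continuous; apply/derivable1_diffP.
  exact: (@ex_derive _ _ _ _ _ _ _ (fd t)).
have key p q : p <= q ->
    exists2 c, p <= c <= q & f q - f p = df c * (q - p).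
  move=> pq; have [|c cpq ->] := @MVT_segment _ f df _ _ pq (fun x _ => fd x).
    exact: continuous_subspaceT.
  by exists c => //; move: cpq; rewrite in_itv.
have [ab|ba] := leP a b.
  have [c /andP[ac cb] ->] := key _ _ ab; exists c => //.
  by rewrite !ger0_norm ?subr_ge0 // lerB.
have [c /andP[bc ca] e] := key _ _ (ltW ba); exists c.
  by rewrite !ler0_norm ?subr_le0 ?(ltW ba) // lerN2 lerB.
by rewrite -opprB e -mulrN opprB.
Qed.

(** The derivative is asked for only near 0, since a semitrough is differentiated only where its
    profile is positive. If [a > 0], then [df] is positive just to the right of 0, and the mean
    value theorem contradicts the maximum. *)
Lemma second_derivative_at_max f df a :
  (\forall t \near 0, is_derive t (1 : R) f (df t)) ->
  is_derive (0 : R) (1 : R) df a ->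
  (\forall t \near 0, f t <= f 0) -> df 0 = 0 /\ a <= 0.
Proof.
move=> fd dfa fmax.
have /nbhs_ballP [r /= r0 near0] :
    \forall t \near 0, is_derive t (1 : R) f (df t) /\ f t <= f 0.
  by apply: filterS2 fd fmax.
have {}near0 t : `|t| < r -> is_derive t (1 : R) f (df t) /\ f t <= f 0.
  by move=> tr; apply: near0; rewrite -ball_normE /= sub0r normrN.
have fd' t : `|t| < r -> is_derive t (1 : R) f (df t) by move=> /near0[].
have fmax' t : `|t| < r -> f t <= f 0 by move=> /near0[].
have df0 : df 0 = 0.
  have [] := @derive1_at_max _ f (- r) r 0 _ _ _ _.
  - by lra.
  - move=> t; rewrite in_itv /= -ltr_norml => tr.
    exact: (@ex_derive _ _ _ _ _ _ _ (fd' t tr)).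
  - by rewrite in_itv /= oppr_lt0 r0.
  - by move=> t; rewrite in_itv /= => tr; apply: fmax'; rewrite ltr_norml.
  have r0' : `|0 : R| < r by rewrite normr0.
  by move=> _; rewrite (@derive_val _ _ _ _ _ _ _ (fd' 0 r0')).
split=> //; rewrite leNgt; apply/negP => a0.
have cv : h^-1 *: ((df \o shift 0) (h *: 1) - df 0) @[h --> 0^'] --> a.
  by case: dfa => dfa <-.
have : \forall h \near 0^', 0 < h^-1 * df h.
  near=> h.
  have -> : h^-1 * df h = h^-1 *: ((df \o shift 0) (h *: 1) - df 0).
    by rewrite /= df0 subr0 addr0 [h *: 1]mulr1.
  by near: h; apply: cvgr_gt cv _ _.
move=> /nbhs_ballP [s /= s0 dfpos].
pose t := Num.min r s / 2.
have m0 : 0 < Num.min r s by rewrite lt_min r0 s0.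
have t0 : 0 < t by rewrite divr_gt0.
have [tr ts] : t < r /\ t < s.
  have : t < Num.min r s by rewrite /t; lra.
  by rewrite lt_min => /andP.
have fd0t x : 0 <= x <= t -> is_derive x (1 : R) f (df x).
  by move=> /andP[x0 xt]; apply: fd'; rewrite ger0_norm // (le_lt_trans xt).
have [| |c] := @MVT _ f df _ _ t0.
- move=> x; rewrite in_itv /= => /andP[x0 xt].
  by apply: fd0t; rewrite !ltW.
- apply: derivable_within_continuous => x; rewrite in_itv /= => xt.
  exact: (@ex_derive _ _ _ _ _ _ _ (fd0t x xt)).
rewrite in_itv /= subr0 => /andP[c0 ct] e.
have : 0 < c^-1 * df c.
  apply: dfpos; last by rewrite gt_eqF.
  by rewrite -ball_normE /= sub0r normrN gtr0_norm // (lt_trans ct).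
rewrite pmulr_rgt0 ?invr_gt0 // => dfc.
have : f t <= f 0 by apply: fmax'; rewrite gtr0_norm.
by rewrite -subr_le0 e leNgt mulr_gt0.
Unshelve. all: by end_near. Qed.

End LineCalculus.

(** * Directional derivatives from continuous partial derivatives *)

Section Directional.
Context {R : realType} {n : nat}.
Implicit Types (w : 'rV[R]_n -> R) (x d : 'rV[R]_n).

Lemma is_derive_line w x d t c :
  is_derive (x + t *: d) d w c ->
  is_derive t (1 : R) (fun s => w (x + s *: d)) c.
Proof.
have e : (fun h => h^-1 *:
      ((w \o shift (x + t *: d)) (h *: d) - w (x + t *: d))) =
    (fun h : R => h^-1 *: (((fun s => w (x + s *: d)) \o shift t) (h *: 1)
      - w (x + t *: d))).
  apply/funext => h /=; congr (_ *: (w _ - _)).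
  by rewrite scalerDl /GRing.scale /= mulr1 addrCA.
move=> [wd wc]; split; first by rewrite /derivable -e.
by rewrite /derive -e.
Qed.

(** One step of the classical argument that continuous partial derivatives give all directional
    ones: a move along the [i]-th axis is controlled by the mean value theorem and the continuity of
    [partial i w]. *)
Lemma is_derive_add_delta w x d c i a :
  (forall y, derivable w y (delta_mx 0 i)) -> continuous (partial i w) ->
  is_derive x d w c ->
  is_derive x (d + a *: delta_mx 0 i) w (c + a * partial i w x).
Proof.
move=> wd wc xdc; set e := delta_mx 0 i.
have slice y b : exists2 s : R, `|s| <= `|b| &
    w (b *: e + y) - w y = b * partial i w (s *: e + y).
  have [|s sb] := @mean_value _ (fun s => w (y + s *: e))
     (fun s => partial i w (y + s *: e)) _ 0 b.
    by move=> t; apply: is_derive_line; split.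
  rewrite !subr0 scale0r addr0 in sb * => h; exists s => //.
  by rewrite ![_ *: e + _]addrC h mulrC.
suff cv : h^-1 *: ((w \o shift x) (h *: (d + a *: e)) - w x) @[h --> 0^']
    --> c + a * partial i w x.
  by split; [apply/cvg_ex; exists (c + a * partial i w x)|exact/cvg_lim].
(* The increment along [d + a *: e] is an increment along [d] followed by one along the axis;
   [slice] turns the latter into a value of [partial i w] at a point close to [x]. *)
have -> : (fun h => h^-1 *: ((w \o shift x) (h *: (d + a *: e)) - w x)) =
   (fun h => h^-1 *: ((w \o shift x) (h *: d) - w x) +
     h^-1 * (w ((h * a) *: e + (h *: d + x)) - w (h *: d + x))).
  apply/funext => h /=.
  rewrite -[LHS]/(h^-1 * _) -[X in _ = X + _]/(h^-1 * _) -mulrDr.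
  have -> : h *: (d + a *: e) + x = (h * a) *: e + (h *: d + x).
    by rewrite scalerDr scalerA addrA [_ *: e + _]addrC.
  by congr (_ * _); ring.
apply: cvgD.
  by case: xdc => xd <-.
apply/cvgrPdist_le => eps eps0.
have ea0 : 0 < eps / (`|a| + 1) by rewrite divr_gt0 // ltr_pwDr.
have /cvgrPdist_le /(_ _ ea0) := wc x.
move=> /nbhs_ballP [rho /= rho0 near_x].
(* The intermediate point lies within [|h| * K] of [x]; the summand 1 only makes [K] positive. *)
pose K := `|d| + `|a| * `|e| + 1.
have K0 : 0 < K by rewrite ltr_pwDr // addr_ge0 // mulr_ge0.
near=> h.
have [s hs ->] := slice (h *: d + x) (h * a).
have h0 : h != 0 by near: h; exact: nbhs_dnbhs_neq.
rewrite mulrA mulKf // -mulrBr normrM.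
have hK : `|h| < rho / K.
  near: h; apply: dnbhs0_lt; exact: divr_gt0.
have : `|partial i w x - partial i w (s *: e + (h *: d + x))| <=
    eps / (`|a| + 1).
  apply: near_x; rewrite -ball_normE /= distrC addrA addrK.
  rewrite (le_lt_trans (ler_normD _ _)) // !normrZ.
  have : `|h| * K < rho by rewrite -ltr_pdivlMr.
  apply: le_lt_trans; rewrite /K !mulrDr mulr1 addrC -addrA lerD2l.
  rewrite ler_wpDr // mulrA ler_wpM2r // (le_trans hs) // normrM //.
move=> /(ler_wpM2l (normr_ge0 a)) /le_trans; apply.
rewrite mulrCA ger_pMr // ler_pdivrMr ?mul1r ?lerDl //.
Unshelve. all: by end_near. Qed.

(** A direction is built from 0 by adding its coordinate components one at a time. *)
Lemma is_derive_grad w : (forall i y, derivable w y (delta_mx 0 i)) ->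
  (forall i, continuous (partial i w)) ->
  forall x d, is_derive x d w (dot (grad w x) d).
Proof.
move=> wd wc x d.
rewrite [d in is_derive x d]row_sum_delta /dot.
pose P (v : 'rV[R]_n) (c : R) := is_derive x v w c.
apply: (big_rec2 (fun c v => is_derive x v w c)) => [|i v c _ ih].
  exact: is_derive0.
rewrite addrC [_ * _ + _]addrC mxE [_ * d 0 i]mulrC.
exact: is_derive_add_delta.
Qed.

End Directional.

(** * Mean curvature as a trace *)

Section MeanCurvature.
Context {R : realType} {n : nat}.
Implicit Types (u : 'rV[R]_n -> R) (x d : 'rV[R]_n).

(** The first form is the rank one perturbation [1 - p^T p] of the identity, and the square of
    [p^T p] is [|p|^2 p^T p]; this is the Sherman-Morrison formula. *)
Lemma first_form_inv u x (p := grad u x) : enorm p < 1 ->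
  invmx (first_form u x) = 1%:M + (1 - enorm p ^+ 2)^-1 *: (p^T *m p).
Proof.
move=> p1; set c := (_)^-1.
have P1 : 1 - enorm p ^+ 2 != 0.
  by rewrite subr_eq0 eq_sym lt_eqF // expr_lt1 ?enorm_ge0.
have A2 : (p^T *m p) *m (p^T *m p) = enorm p ^+ 2 *: (p^T *m p).
  rewrite mulmxA -[p^T *m p *m p^T]mulmxA.
  suff -> : p *m p^T = (enorm p ^+ 2)%:M by rewrite mul_mx_scalar scalemxAl.
  apply/matrixP => i j; rewrite !ord1 mxE [RHS]mxE eqxx mulr1n enorm_sqr.
  by apply: eq_bigr => k _; rewrite [p^T _ _]mxE.
have -> : first_form u x = 1%:M - p^T *m p.
  by apply/matrixP => i j; rewrite !mxE big_ord1 !mxE.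
have inv : (1%:M - p^T *m p) *m (1%:M + c *: (p^T *m p)) = 1%:M.
  rewrite mulmxDr mulmx1 -scalemxAr mulmxBl mul1mx A2.
  rewrite -[X in c *: (X - _)]scale1r -scalerBl scalerA /c mulVf // scale1r.
  by rewrite subrK.
have [U _] := mulmx1_unit inv.
by rewrite -[RHS](mulKmx U) inv mulmx1.
Qed.

(** The coefficient of degree [n - 1] of the characteristic polynomial is minus the trace, and for
    the product of linear factors it is minus the sum of the roots. The trace of [g^-1 h] is then
    expanded with [first_form_inv]. *)
Lemma sigma1_trace u x kappa (p := grad u x) (H := hessian u x) :
  (0 < n)%N -> enorm p < 1 -> principal_curvatures u x kappa ->
  sigma1 kappa * Num.sqrt (1 - enorm p ^+ 2) =
    \tr H + dot (p *m H) p / (1 - enorm p ^+ 2).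
Proof.
move=> n0 p1 /(congr1 (fun q : {poly R} => q`_n.-1)).
have s0 : 0 < 1 - enorm p ^+ 2.
  by rewrite subr_gt0 expr_lt1 ?enorm_ge0.
rewrite char_poly_trace //.
have -> : (\prod_(i < n) ('X - (kappa 0 i)%:P))`_n.-1 = - sigma1 kappa.
  have -> : \prod_(i < n) ('X - (kappa 0 i)%:P) =
      \prod_(a <- [seq kappa 0 i | i <- index_enum 'I_n]) ('X - a%:P).
    by rewrite big_map.
  have sz : size [seq kappa 0 i | i <- index_enum 'I_n] = n.
    by rewrite size_map /index_enum -enumT size_enum_ord.
  move: (coefPn_prod_XsubC (ps := [seq kappa 0 i | i <- index_enum 'I_n])).
  by rewrite sz -lt0n => -> //; rewrite big_map.
move=> /oppr_inj <-.
have -> : second_form u x = (Num.sqrt (1 - enorm p ^+ 2))^-1 *: H.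
  by apply/matrixP => i j; rewrite !mxE mulrC.
rewrite -scalemxAr linearZ /= mulrC mulVKf ?gt_eqF ?sqrtr_gt0 //.
rewrite first_form_inv // mulmxDl mul1mx -scalemxAl linearD linearZ /=.
rewrite -mulmxA mxtrace_mulC mulrC; congr (_ + _ * _).
rewrite /mxtrace big_ord1 mxE; apply: eq_bigr => i _.
by rewrite [_^T _ _]mxE.
Qed.

Lemma smooth_is_derive_line u x d t : smooth u ->
  is_derive t (1 : R) (fun s => u (x + s *: d)) (dot (grad u (x + t *: d)) d).
Proof.
move=> us; apply: is_derive_line; apply: is_derive_grad => [i y|i].
  exact: (us [::]).2.
exact: (us [:: i]).1.
Qed.

Lemma smooth_is_derive2_line u x d : smooth u ->
  is_derive (0 : R) (1 : R) (fun s => dot (grad u (x + s *: d)) d)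
    (dot (d *m hessian u x) d).
Proof.
move=> us.
have -> : (fun s => dot (grad u (x + s *: d)) d) =
    \sum_(i < n) (d 0 i \*: (fun s : R => partial i u (x + s *: d))).
  apply/funext => s; rewrite fct_sumE; apply: eq_bigr => i _.
  by rewrite mxE mulrC.
have -> : dot (d *m hessian u x) d =
    \sum_(i < n) d 0 i *: dot (grad (partial i u) x) d.
  rewrite /dot; under eq_bigr do rewrite mxE mulr_suml.
  rewrite exchange_big; apply: eq_bigr => i _.
  rewrite -[RHS]/(_ * _) mulr_sumr; apply: eq_bigr => j _.
  by rewrite !mxE; ring.
apply: is_derive_sum => i; apply: is_deriveZ; apply: is_derive_line.
rewrite scale0r addr0; apply: is_derive_grad => [j y|j].
  exact: (us [:: i]).2.
exact: (us [:: j; i]).1.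
Qed.

End MeanCurvature.

(** * Differentiation rules in pointwise form *)

Section PointwiseDerivatives.
Context {R : realType}.
Implicit Types (f g : R -> R) (t df dg c : R).

Lemma derive_constant c t : is_derive t (1 : R) (fun=> c) 0.
Proof. exact: is_derive_cst. Qed.

Lemma derive_identity t : is_derive t (1 : R) (fun s => s) 1.
Proof. exact: is_derive_id. Qed.

Lemma derive_add f g t df dg : is_derive t (1 : R) f df ->
  is_derive t (1 : R) g dg ->
  is_derive t (1 : R) (fun s => f s + g s) (df + dg).
Proof. exact: is_deriveD. Qed.

Lemma derive_opp f t df : is_derive t (1 : R) f df ->
  is_derive t (1 : R) (fun s => - f s) (- df).
Proof. exact: is_deriveN. Qed.

Lemma derive_mul f g t df dg : is_derive t (1 : R) f df ->
  is_derive t (1 : R) g dg ->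
  is_derive t (1 : R) (fun s => f s * g s) (f t * dg + g t * df).
Proof. exact: is_deriveM. Qed.

Lemma derive_sqr f t df : is_derive t (1 : R) f df ->
  is_derive t (1 : R) (fun s => f s ^+ 2) (2 * f t * df).
Proof.
move=> fd; have := derive_mul fd fd.
have -> : (fun s => f s * f s) = (fun s => f s ^+ 2) by [].
by move/is_derive_eq; apply; ring.
Qed.

Lemma derive_inv f t df : f t != 0 -> is_derive t (1 : R) f df ->
  is_derive t (1 : R) (fun s => (f s)^-1) (- (f t ^- 2) * df).
Proof. exact: is_deriveV. Qed.

Lemma derive_comp f g t df dg : is_derive (g t) (1 : R) f df ->
  is_derive t (1 : R) g dg -> is_derive t (1 : R) (fun s => f (g s)) (df * dg).
Proof. exact: is_derive1_comp. Qed.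

End PointwiseDerivatives.

(** * Restriction of a semitrough to a line *)

Section ProfileLine.
Context {R : realType}.
Variables (g g1 : R -> R) (g2 a d1 b c e : R).
Hypothesis g_derive : forall t, is_derive t (1 : R) g (g1 t).

(** Square of a semitrough along [x + t d]: [a] and [d1] are the first coordinates of [x] and [d],
    while [b], [c], [e] stand for [|xbar x|^2], [xbar x . xbar d], [|xbar d|^2]. [dq] is half of its
    derivative. *)
Let q (t : R) := g (a + t * d1) ^+ 2 + (b + 2 * t * c + t ^+ 2 * e).
Let dq (t : R) := g (a + t * d1) * g1 (a + t * d1) * d1 + c + t * e.

Let affine_derive t : is_derive t (1 : R) (fun t => a + t * d1) d1.
Proof.
apply: (is_derive_eq (derive_add (derive_constant a t)
  (derive_mul (derive_identity t) (derive_constant d1 t)))).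
by rewrite /GRing.scale /=; ring.
Qed.

Let g_affine_derive t :
  is_derive t (1 : R) (fun t => g (a + t * d1)) (g1 (a + t * d1) * d1).
Proof. exact: derive_comp (g_derive _) (affine_derive t). Qed.

Let quadratic_derive t :
  is_derive t (1 : R) (fun t => b + 2 * t * c + t ^+ 2 * e) (2 * (c + t * e)).
Proof.
apply: (is_derive_eq ((derive_add (derive_add (derive_constant b t)
    (derive_mul (derive_mul (derive_constant 2 t) (derive_identity t))
      (derive_constant c t)))
    (derive_mul (derive_sqr (derive_identity t)) (derive_constant e t))))).
by rewrite /GRing.scale /= ; ring.
Qed.

Let q_derive t : is_derive t (1 : R) q (2 * dq t).
Proof.
apply: (is_derive_eq (derive_add (derive_sqr (g_affine_derive t))
  (quadratic_derive t))).
by rewrite /GRing.scale /= /dq; ring.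
Qed.

Lemma profile_line_derive t : 0 < q t ->
  is_derive t (1 : R) (fun t => Num.sqrt (q t)) (dq t / Num.sqrt (q t)).
Proof.
move=> q0.
apply: (is_derive_eq (derive_comp (is_derive1_sqrt q0) (q_derive t))).
by field; rewrite sqrtr_eq0 -ltNge.
Qed.

(** With [Q] the square root of [q], [Q Q' = dq], so [Q'' = (dq' - Q'^2) / Q]. *)
Lemma profile_line_derive2 : is_derive a (1 : R) g1 g2 -> 0 < q 0 ->
  is_derive (0 : R) (1 : R) (fun t => dq t / Num.sqrt (q t))
   (((g1 a ^+ 2 + g a * g2) * d1 ^+ 2 + e - (dq 0 / Num.sqrt (q 0)) ^+ 2)
      / Num.sqrt (q 0)).
Proof.
move=> g1d q0.
have a0 : a + 0 * d1 = a by rewrite mul0r addr0.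
have dqd : is_derive (0 : R) (1 : R) dq ((g1 a ^+ 2 + g a * g2) * d1 ^+ 2 + e).
  have g1' : is_derive (0 : R) (1 : R) (fun t => g1 (a + t * d1)) (g2 * d1).
    apply: derive_comp (affine_derive 0); by rewrite a0.
  apply: (is_derive_eq ((derive_add (derive_add
      (derive_mul (derive_mul (g_affine_derive 0) g1')
      (derive_constant d1 0)) (derive_constant c 0))
      (derive_mul (derive_identity 0) (derive_constant e 0))))).
  by rewrite /GRing.scale /= a0; ring.
have s0 : Num.sqrt (q 0) != 0 by rewrite sqrtr_eq0 -ltNge.
apply: (is_derive_eq (derive_mul dqd
  (derive_inv (f := fun t => Num.sqrt (q t)) s0 (profile_line_derive q0)))).
by rewrite /GRing.scale /=; field.
Qed.

End ProfileLine.

(** * Contact with a semitrough *)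

Section Touching.
Context {R : realType} {m : nat}.
Implicit Types (u : 'rV[R]_m.+1 -> R) (x d p : 'rV[R]_m.+1) (g : R -> R).

Lemma semitrough_line g x d t : semitrough g (x + t *: d) =
  Num.sqrt (g (x1 x + t * x1 d) ^+ 2 + (enorm (xbar x) ^+ 2 +
    2 * t * dot (xbar x) (xbar d) + t ^+ 2 * enorm (xbar d) ^+ 2)).
Proof.
rewrite /semitrough x1D x1Z xbarD xbarZ !enorm_sqr.
rewrite !(dotDl, dotDr, dotZl, dotZr) (dotC (xbar d) (xbar x)).
by congr (Num.sqrt (_ + _)); ring.
Qed.

Lemma semitrough_sqr g x :
  semitrough g x ^+ 2 = g (x1 x) ^+ 2 + enorm (xbar x) ^+ 2.
Proof. by rewrite sqr_sqrtr // addr_ge0 ?sqr_ge0. Qed.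

Lemma semitrough_ge0 g x : 0 <= semitrough g x.
Proof. exact: sqrtr_ge0. Qed.

Lemma semitrough_gt0 g x : g (x1 x) != 0 -> 0 < semitrough g x.
Proof.
by move=> g0; rewrite sqrtr_gt0 ltr_pwDl ?sqr_ge0 // exprn_even_gt0.
Qed.

(** Keeps the square root differentiable along a neighbourhood of the contact point. *)
Lemma line_gt0_near g g' (a b : R) : (forall t, is_derive t (1 : R) g (g' t)) ->
  0 < g a -> \forall t \near (0 : R), 0 < g (a + t * b).
Proof.
move=> gd ga.
have g_cont : {for (0 : R), continuous (fun t : R => g (a + t * b))}.
  apply: differentiable_continuous; apply/derivable1_diffP.
  have ad t : is_derive t (1 : R) (fun t => a + t * b) b.
    apply: (is_derive_eq (derive_add (derive_constant a t)
      (derive_mul (derive_identity t) (derive_constant b t)))).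
    by ring.
  exact: (@ex_derive _ _ _ _ _ _ _ (derive_comp (gd _) (ad _))).
by apply: cvgr_gt g_cont _ _; rewrite mul0r addr0.
Qed.

Section AtContact.
Variables (u : 'rV[R]_m.+1 -> R) (x : 'rV[R]_m.+1).
Variables (g g1 : R -> R) (g2 sigma : R).
Hypotheses (u_smooth : smooth u) (sigma0 : sigma != 0).
Hypothesis g_derive : forall t, is_derive t (1 : R) g (g1 t).
Hypothesis g1_derive : is_derive (x1 x) (1 : R) g1 g2.
Hypothesis gx : 0 < g (x1 x).
Hypothesis contact : forall d, \forall t \near (0 : R),
  sigma * (u (x + t *: d) - semitrough g (x + t *: d)) <=
  sigma * (u x - semitrough g x).

Let G := g (x1 x).
Let p := grad u x.
Let v := semitrough g x.
Let A := g1 (x1 x) ^+ 2 + G * g2.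

(** The sign [sigma] treats both contacts at once: [1] at a maximum of [u - semitrough g], [-1] at a
    maximum of the opposite. The two conclusions are the first and second derivative tests on the
    line; [|xbar d|^2] is rewritten as [dot d d - x1 d ^+ 2], which is convenient for summing over a
    basis. *)
Lemma contact_along d :
  dot p d = (G * g1 (x1 x) * x1 d + dot (xbar x) (xbar d)) / v /\
  sigma * (dot (d *m hessian u x) d -
    ((A - 1) * x1 d ^+ 2 + dot d d - dot p d ^+ 2) / v) <= 0.
Proof.
pose c := dot (xbar x) (xbar d); pose e := enorm (xbar d) ^+ 2.
pose q t := g (x1 x + t * x1 d) ^+ 2 +
  (enorm (xbar x) ^+ 2 + 2 * t * c + t ^+ 2 * e).
pose dq t := g (x1 x + t * x1 d) * g1 (x1 x + t * x1 d) * x1 d + c + t * e.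
have qE t : Num.sqrt (q t) = semitrough g (x + t *: d).
  by rewrite semitrough_line.
have q_pos t : 0 < g (x1 x + t * x1 d) -> 0 < q t.
  move=> gt; rewrite -sqrtr_gt0 qE semitrough_gt0 // x1D x1Z.
  by rewrite gt_eqF.
have q0v : Num.sqrt (q 0) = v by rewrite qE scale0r addr0.
have q0 : 0 < q 0 by apply: q_pos; rewrite mul0r addr0.
have dq0 : dq 0 = G * g1 (x1 x) * x1 d + c.
  by rewrite /dq !mul0r !addr0.
have g_near := line_gt0_near (x1 d) g_derive gx.
pose F t := sigma * (u (x + t *: d) - Num.sqrt (q t)).
pose dF t := sigma * (dot (grad u (x + t *: d)) d - dq t / Num.sqrt (q t)).
have scaled f h df dh t :
    is_derive t (1 : R) f df -> is_derive t (1 : R) h dh ->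
    is_derive t (1 : R) (fun s => sigma * (f s - h s)) (sigma * (df - dh)).
  by move=> fd hd; exact: (is_deriveZ sigma (is_deriveB fd hd)).
have Fd : \forall t \near (0 : R), is_derive t (1 : R) F (dF t).
  apply: filterS g_near => t gt; apply: scaled.
    exact: smooth_is_derive_line.
  exact: profile_line_derive (q_pos t gt).
have dFd : is_derive (0 : R) (1 : R) dF (sigma * (dot (d *m hessian u x) d -
    (A * x1 d ^+ 2 + e - (dq 0 / v) ^+ 2) / v)).
  rewrite -q0v; apply: scaled (smooth_is_derive2_line x d u_smooth) _.
  exact: profile_line_derive2 g_derive g1_derive q0.
have [] := second_derivative_at_max Fd dFd.
  apply: filterS (contact d) => t; rewrite /F !qE.
  by rewrite scale0r addr0.
rewrite /dF q0v dq0 scale0r addr0 -/p => /eqP.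
rewrite mulf_eq0 (negbTE sigma0) /= subr_eq0 => /eqP pd.
move=> le0; split; first exact: pd.
move: le0; rewrite -pd; congr (sigma * (_ - _ / v) <= 0).
by rewrite /e (dot_split d d) -(enorm_sqr (xbar d)); ring.
Qed.

Lemma contact_gradient : p = v^-1 *: cons_row (G * g1 (x1 x)) (xbar x).
Proof.
apply/rowP => i; rewrite -[LHS]dot_delta (contact_along _).1 -[RHS]dot_delta.
by rewrite dotZl dot_split x1_cons xbar_cons mulrC.
Qed.

(** The mean curvature is the combination of second derivatives along the [e_i], with weight 1, and
    along the common gradient [p], with weight [1 / (1 - |p|^2)]. The weights are nonnegative, so
    the second derivative tests add up to an inequality between the mean curvatures of [u] and of
    the semitrough. *)
Lemma contact_curvature (s := Num.sqrt (1 - g1 (x1 x) ^+ 2)) :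
  spacelike u ->
  (exists kappa, principal_curvatures u x kappa /\ sigma1 kappa = m.+1%:R) ->
  0 < 1 - g1 (x1 x) ^+ 2 /\
  sigma * (m.+1%:R * s ^+ 3 - (g2 + m%:R * s ^+ 2 / G)) <= 0.
Proof.
move=> u_sp [kappa [pc sk]].
have v0 : 0 < v by apply: semitrough_gt0; rewrite gt_eqF.
have P1 : enorm p < 1 := u_sp x.
pose P := dot p p; pose a := g1 (x1 x).
have P1' : 0 < 1 - P by rewrite subr_gt0 /P -enorm_sqr expr_lt1 ?enorm_ge0.
have x1p : x1 p = G * a / v by rewrite contact_gradient x1Z x1_cons mulrC.
(* From [v^2 = G^2 + |xbar x|^2]. As [u] is spacelike, the profile has slope less than 1 in absolute
   value at the contact point. *)
have defect : 1 - P = (1 - a ^+ 2) * (G / v) ^+ 2.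
  apply: (@mulfI _ (v ^+ 2)); first by rewrite expf_neq0 // gt_eqF.
  rewrite /P dot_split x1p contact_gradient xbarZ xbar_cons dotZl dotZr.
  rewrite -enorm_sqr mulrBr mulr1 {1}semitrough_sqr -/G.
  by field; rewrite gt_eqF.
have a1 : 0 < 1 - a ^+ 2.
  by move: P1'; rewrite defect pmulr_lgt0 // exprn_gt0 // divr_gt0.
split=> //.
have s0 : 0 < s by rewrite sqrtr_gt0.
have s2 : s ^+ 2 = 1 - a ^+ 2 by rewrite sqr_sqrtr // ltW.
have sqrtE : Num.sqrt (1 - P) = s * (G / v).
  by rewrite defect sqrtrM ?(ltW a1) // sqrtr_sqr ger0_norm // divr_ge0 // ltW.
have := sigma1_trace (ltn0Sn m) P1 pc.
rewrite sk enorm_sqr -/p -/P sqrtE => tr.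
pose B d := ((A - 1) * x1 d ^+ 2 + dot d d - dot p d ^+ 2) / v.
have trB : \sum_(i < m.+1) B (delta_mx 0 i) = (A - 1 + m.+1%:R - P) / v.
  rewrite -mulr_suml; congr (_ / v); rewrite sumrB big_split /= -mulr_sumr.
  congr (_ + _ - _).
  - rewrite (bigD1 ord0) //= big1 => [|i i0].
      by rewrite /x1 mxE !eqxx expr1n addr0 mulr1.
    by rewrite /x1 mxE eqxx eq_sym (negbTE i0) expr0n.
  - under eq_bigr do rewrite dot_delta mxE !eqxx.
    by rewrite sumr_const card_ord.
  - by apply: eq_bigr => i _; rewrite dot_delta expr2.
(* The trace of [g^-1 D^2] only involves the directions [e_i] and [p]. *)
have trace_le : sigma * (\tr (hessian u x) - (A - 1 + m.+1%:R - P) / v) <= 0.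
  rewrite -trB /mxtrace -sumrB mulr_sumr; apply: sumr_le0 => i _.
  have := (contact_along (delta_mx 0 i)).2; rewrite dot_delta.
  by congr (sigma * (_ - _) <= 0); rewrite -rowE mxE.
have quad_le : sigma * (dot (p *m hessian u x) p - B p) / (1 - P) <= 0.
  rewrite pmulr_lle0 ?invr_gt0 //; exact: (contact_along p).2.
(* This factor turns [m.+1 * s^3] into [m.+1 * sqrt (1 - P)], the value given by [sigma1_trace], and
   the other term into [(G * g2 / s^2 + m) / v]. *)
rewrite -(pmulr_rle0 _ (_ : 0 < G / (v * s ^+ 2))); last first.
  by rewrite !(mulr_gt0, invr_gt0, exprn_gt0).
apply: le_trans (_ : sigma * (\tr (hessian u x) - (A - 1 + m.+1%:R - P) / v) +
   sigma * (dot (p *m hessian u x) p - B p) / (1 - P) <= 0); last first.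
  by rewrite -(addr0 0) lerD.
have -> : sigma * (\tr (hessian u x) - (A - 1 + m.+1%:R - P) / v) +
   sigma * (dot (p *m hessian u x) p - B p) / (1 - P) =
  sigma * ((\tr (hessian u x) + dot (p *m hessian u x) p / (1 - P)) -
   ((A - 1 + m.+1%:R - P) / v + B p / (1 - P))) by ring.
rewrite -tr.
have -> : (A - 1 + m.+1%:R - P) / v + B p / (1 - P) =
    (G * g2 / s ^+ 2 + m%:R) / v.
  have -> : B p / (1 - P) = ((A - 1) * a ^+ 2 / s ^+ 2 + P) / v.
    rewrite /B -/P x1p.
    have -> : (A - 1) * (G * a / v) ^+ 2 + P - P ^+ 2 =
       (A - 1) * (G * a / v) ^+ 2 + P * (1 - P) by ring.
    have ratio : (G * a / v) ^+ 2 / (1 - P) = a ^+ 2 / s ^+ 2.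
      by rewrite defect -s2; field; rewrite !gt_eqF.
    rewrite -[(A - 1) * _ / _]mulrA -ratio; field.
    by rewrite !gt_eqF.
  have -> : A = 1 - s ^+ 2 + G * g2 by rewrite s2 /A -/a; ring.
  have -> : a ^+ 2 = 1 - s ^+ 2 by rewrite s2; ring.
  by rewrite -natr1; field; rewrite !gt_eqF.
rewrite le_eqVlt; apply/orP; left; apply/eqP; rewrite -natr1; field.
by rewrite !gt_eqF.
Qed.

End AtContact.
End Touching.

(** * Asymptotics *)

Section HalfSphereSupport.
Context {R : realType} {m : nat}.
Implicit Types (x l : 'rV[R]_m.+1).

(** Provides the nonemptiness under which the supremum [V_half_sphere] can be bounded above. *)
Lemma half_sphere_axis : half_sphere (delta_mx 0 0 : 'rV[R]_m.+1).
Proof.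
split; last by rewrite /x1 mxE !eqxx.
by rewrite /enorm dot_delta mxE !eqxx sqrtr1.
Qed.

Lemma dot_le_V x l : half_sphere l -> dot x l <= V_half_sphere x.
Proof.
move=> hl; apply: ub_le_sup; last by exists l.
exists (enorm x) => _ [k [k1 _] <-].
by rewrite (le_trans (cauchy_schwarz _ _)) // k1 mulr1.
Qed.

Lemma V_le x c :
  (forall l, half_sphere l -> dot x l <= c) -> V_half_sphere x <= c.
Proof.
move=> xc; apply: ge_sup; last by move=> _ [l hl <-]; exact: xc.
by exists (dot x (delta_mx 0 0)), (delta_mx 0 0) => //; exact: half_sphere_axis.
Qed.

(** With the bounds that follow, this evaluates [V_half_sphere x]: it is [enorm x] where [x1 x >= 0]
    and, if [m > 0], [enorm (xbar x)] where [x1 x <= 0]. *)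
Lemma V_le_enorm x : V_half_sphere x <= enorm x.
Proof.
apply: V_le => l [l1 _].
by rewrite (le_trans (cauchy_schwarz _ _)) // l1 mulr1.
Qed.

Lemma V_le_enorm_xbar x : x1 x <= 0 -> V_half_sphere x <= enorm (xbar x).
Proof.
move=> x0; apply: V_le => l [l1 l0].
rewrite dot_split -[leRHS]add0r lerD ?mulr_le0_ge0 //.
rewrite (le_trans (cauchy_schwarz _ _)) // ler_piMr ?enorm_ge0 //.
by rewrite -l1 enorm_xbar_le.
Qed.

Lemma half_sphere_normalize x : 0 < enorm x -> 0 <= x1 x ->
  half_sphere ((enorm x)^-1 *: x).
Proof.
move=> n0 x0; split; last by rewrite x1Z mulr_ge0 // invr_ge0 ltW.
by rewrite enormZ ger0_norm ?invr_ge0 ?enorm_ge0 // mulVf // gt_eqF.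
Qed.

Lemma enorm_le_V x : 0 <= x1 x -> enorm x <= V_half_sphere x.
Proof.
move=> x0; have [/enorm_eq0 ->|n0] := eqVneq (enorm x) 0.
  have := dot_le_V 0 half_sphere_axis.
  by rewrite enorm0 dot_delta mxE.
have np : 0 < enorm x by rewrite lt_neqAle eq_sym n0 enorm_ge0.
apply: le_trans (dot_le_V x (half_sphere_normalize np x0)).
by rewrite dotZr -enorm_sqr expr2 mulKf.
Qed.

Lemma enorm_xbar_le_V x : (0 < m)%N -> enorm (xbar x) <= V_half_sphere x.
Proof.
move=> m0; have [r0|n0] := eqVneq (enorm (xbar x)) 0.
  (* If [xbar x] vanishes it cannot be normalized; any axis other than the first, available as
     [0 < m], gives [0 <= V]. *)
  pose i : 'I_m.+1 := lift ord0 (Ordinal m0).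
  have hl : half_sphere (delta_mx 0 i : 'rV[R]_m.+1).
    split; last by rewrite /x1 mxE.
    by rewrite /enorm dot_delta mxE !eqxx sqrtr1.
  have := dot_le_V x hl; rewrite dot_delta.
  by have /rowP /(_ (Ordinal m0)) := enorm_eq0 r0; rewrite !mxE r0 => ->.
pose y := cons_row 0 (xbar x).
have y_bar : enorm y = enorm (xbar x).
  apply: (@pexpIrn _ 2); rewrite ?nnegrE ?enorm_ge0 //.
  by rewrite enorm_split x1_cons xbar_cons expr0n add0r.
have yp : 0 < enorm y by rewrite y_bar lt_neqAle eq_sym n0 enorm_ge0.
have y0 : 0 <= x1 y by rewrite x1_cons.
apply: le_trans (dot_le_V x (half_sphere_normalize yp y0)).
rewrite dotZr dot_split x1_cons xbar_cons mulr0 add0r y_bar -enorm_sqr expr2.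
by rewrite mulKf.
Qed.

End HalfSphereSupport.

(** * Comparison of a spacelike function with its asymptotic cone *)

Section Asymptotics.
Context {R : realType} {m : nat}.
Variable u : 'rV[R]_m.+1 -> R.
Hypotheses (u_smooth : smooth u) (u_spacelike : spacelike u).
Hypothesis u_lim_half_sphere : forall e : R, 0 < e -> exists M : R,
  forall x, M < enorm x -> half_sphere ((enorm x)^-1 *: x) ->
    `|u x - V_half_sphere x| < e.

Lemma spacelike_lipschitz x y : u x <= u y + enorm (x - y).
Proof.
have [|c _] := mean_value (f := fun t => u (y + t *: (x - y)))
  (df := fun t => dot (grad u (y + t *: (x - y))) (x - y)) _ 0 1.
  by move=> t; exact: smooth_is_derive_line.
rewrite scale1r scale0r addr0 subr0 mulr1 [y + (x - y)]addrC subrK => e.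
rewrite -lerBlDl e (le_trans (cauchy_schwarz _ _)) // ler_piMl ?enorm_ge0 //.
exact/ltW/u_spacelike.
Qed.

(** For [l] in the half sphere and [s] large, [u (s l)] is at least [s] up to a small error, while
    [|s l - x|] tends to [s - x . l]; the Lipschitz bound then gives [x . l <= u x]. *)
Lemma V_le_spacelike x : V_half_sphere x <= u x.
Proof.
apply: V_le => l hl; apply/ler_addgt0Pr => e e0.
have e20 : 0 < e / 2 by lra.
have [M HM] := u_lim_half_sphere e20.
pose k := dot x l; pose N := enorm x ^+ 2.
have N0 : 0 <= N / e by rewrite divr_ge0 ?sqr_ge0 // ltW.
(* Beyond the threshold [M], and such that [N <= e (s - k)], which makes
   [|s l - x|^2 = s^2 - 2 s k + N] at most [(s - k + e / 2)^2]. *)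
pose s := `|M| + 1 + `|k| + N / e.
have Ms : M < s.
  by have := ler_norm M; have := normr_ge0 k; rewrite /s; lra.
have s0 : 0 < s.
  by have := normr_ge0 M; have := normr_ge0 k; rewrite /s; lra.
have sk : N / e <= s - k.
  by have := normr_ge0 M; have := ler_norm k; rewrite /s; lra.
have ns : enorm (s *: l) = s by rewrite enormZ hl.1 mulr1 gtr0_norm.
have : `|u (s *: l) - V_half_sphere (s *: l)| < e / 2.
  apply: HM; rewrite ns // scalerA mulVf ?scale1r // gt_eqF //.
rewrite ltr_norml => /andP[lo _].
have Vs : s <= V_half_sphere (s *: l).
  apply: le_trans (dot_le_V _ hl).
  by rewrite dotZl -enorm_sqr hl.1 expr1n mulr1.
have := spacelike_lipschitz (s *: l) x.
have : enorm (s *: l - x) <= s - k + e / 2.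
  rewrite -(@ler_pXn2r _ 2) ?nnegrE ?enorm_ge0 //; last by lra.
  rewrite enorm_sqrB ns dotZl (dotC l x) -/k -/N.
  have : N <= e * (s - k) by rewrite mulrC -ler_pdivrMr.
  have := sqr_ge0 (k - 0); have := sqr_ge0 e; rewrite subr0; nra.
by rewrite -/k; lra.
Qed.

Hypothesis u_lim_flat : forall e : R, 0 < e -> exists M : R,
  forall x, x1 x < - M -> M < enorm (xbar x) -> `|u x - V_half_sphere x| < e.

(* The strip where [x1] is negative and bounded is not covered by the two limit
   hypotheses; there [u x] is compared with [u] at the point of the hyperplane
   [x1 = 0] whose second component is shorter than [xbar x] by [L]. *)
Lemma spacelike_le_V_far (e : R) : (0 < m)%N -> 0 < e -> exists M : R,
  forall x, M < x1 x \/ M < enorm (xbar x) -> u x <= V_half_sphere x + e.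
Proof.
move=> m0 e0; have e20 : 0 < e / 2 by lra.
have [M1 H1] := u_lim_half_sphere e20.
have [M2 H2] := u_lim_flat e20.
(* Then [M2^2 <= L e], hence [sqrt (L^2 + M2^2) <= L + e / 2]: the loss from the displacement in
   [x1] is small. *)
pose L := M2 ^+ 2 / e + 1.
have L0 : 0 < L by rewrite ltr_pwDr // divr_ge0 ?sqr_ge0 // ltW.
have half x : 0 <= x1 x -> `|M1| < enorm x -> u x <= V_half_sphere x + e / 2.
  move=> x0 Mx; have n0 : 0 < enorm x by rewrite (le_lt_trans _ Mx).
  have := H1 x (le_lt_trans (ler_norm M1) Mx) (half_sphere_normalize n0 x0).
  by rewrite ltr_norml; lra.
have nM1 := normr_ge0 M1; have nM2 := normr_ge0 M2.
exists (`|M1| + `|M2| + L) => x hx.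
have [x0|x0] := leP 0 (x1 x).
  apply: le_trans (half x x0 _) _; last by lra.
  have := enorm_xbar_le x.
  have := normr_coord_le_enorm x ord0; rewrite -/(x1 x) ger0_norm //.
  by case: hx; lra.
have {}hx : `|M1| + `|M2| + L < enorm (xbar x) by case: hx => //; lra.
have [x2|x2] := ltP (x1 x) (- M2).
  have : M2 < enorm (xbar x) by have := ler_norm M2; lra.
  by move=> /(H2 x x2); rewrite ltr_norml; lra.
set r := enorm (xbar x) in hx.
have r0 : 0 < r by lra.
pose y := cons_row 0 ((1 - L / r) *: xbar x).
have Lr : 0 <= 1 - L / r by rewrite subr_ge0 ler_pdivrMr // mul1r; lra.
have ny : enorm y = r - L.
  apply: (@pexpIrn _ 2); rewrite ?nnegrE ?enorm_ge0 //; first by lra.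
  rewrite enorm_split x1_cons xbar_cons enormZ -/r ger0_norm // expr0n add0r.
  by congr (_ ^+ 2); field; rewrite gt_eqF.
have nxy : enorm (x - y) <= L + e / 2.
  rewrite -(@ler_pXn2r _ 2) ?nnegrE ?enorm_ge0 //; last by lra.
  have -> : x - y = x + -1 *: y by rewrite scaleN1r.
  rewrite enorm_split x1D xbarD x1Z xbarZ x1_cons xbar_cons mulr0 addr0.
  have -> : xbar x + -1 *: ((1 - L / r) *: xbar x) = (L / r) *: xbar x.
    rewrite scalerA -{1}[xbar x]scale1r -scalerDl.
    by congr (_ *: _); ring.
  rewrite enormZ -/r ger0_norm; last by rewrite divr_ge0 // ltW.
  rewrite divfK ?gt_eqF //.
  have : x1 x ^+ 2 <= M2 ^+ 2.
    by rewrite -sqrrN ler_pXn2r ?nnegrE //; lra.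
  have : L * e = M2 ^+ 2 + e by rewrite /L; field; rewrite gt_eqF.
  by have := sqr_ge0 e; nra.
have uy : u y <= r - L + e / 2.
  rewrite -ny; apply: le_trans (half y _ _) _; rewrite ?x1_cons ?ny //.
    by lra.
  by rewrite lerD2r -ny V_le_enorm.
have := spacelike_lipschitz x y.
by have := enorm_xbar_le_V x m0; rewrite -/r; lra.
Qed.

End Asymptotics.

(** * Perturbed profiles *)

Section PerturbationAlgebra.
Context {R : realType}.
Implicit Types (k f p q s h e a : R).

Lemma profile_ode_div k f q s : 0 < f -> 0 < s ->
  q + k * s ^+ 2 / f = (k + 1) * s ^+ 3 -> q / s ^+ 2 + k / f = (k + 1) * s.
Proof.
move=> f0 s0 ode.
have -> : q / s ^+ 2 + k / f = (q + k * s ^+ 2 / f) / s ^+ 2.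
  by field; rewrite !gt_eqF.
by rewrite ode; field; rewrite gt_eqF.
Qed.

(** Here [f, p, q] are the profile and its first two derivatives at a point, [h, h1, h2] those of
    [gap], and [s, a] the slope defects before and after the perturbation. After division by [a^2]
    the left side is at most [(k + 1 + 8 e) s / th], the right side at least
    [(k + 1) (1 + 16 e) th s]. *)
Lemma perturbation_supersolution k f p q s h (h1 h2 : R) e a (k1 : 1 <= k)
    (f0 : 0 < f) (h0 : 0 <= h) (s0 : 0 < s) (p0 : 0 < p) (q0 : 0 < q)
    (sE : s ^+ 2 = 1 - p ^+ 2) (ode : q + k * s ^+ 2 / f = (k + 1) * s ^+ 3)
    (h2_le : h2 <= 8 * s ^+ 3) (h1_le0 : h1 <= 0) (h1_ge : - 2 <= h1)
    (h2_ge0 : 0 <= h2) (a0 : 0 < a) :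
  0 < e <= 64^-1 ->
  a ^+ 2 = 1 - (p + e * h1) ^+ 2 ->
  q + e * h2 + k * a ^+ 2 / (f + e * h) < (k + 1) * (1 + 16 * e) * a ^+ 3.
Proof.
move=> /andP[e0 e64] aE.
have e64' : e <= 1 / 64 by rewrite div1r.
have ode' := profile_ode_div f0 s0 ode.
have s1 : s <= 1.
  rewrite -(@ler_pXn2r _ 2) ?nnegrE ?ler01 ?(ltW s0) // expr1n sE.
  by rewrite lerBlDr lerDl sqr_ge0.
(* Lower bound for [a^2 / s^2]: the slope decreases, so [a >= s] unless it becomes negative, and
   then it is at least [- 2 e] because [h1 >= - 2]. *)
pose th : R := 1 - 4 * e ^+ 2.
have e2 : e ^+ 2 <= e / 64 by nra.
have th0 : 0 < th by rewrite /th; lra.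
have th1 : th <= 1 by rewrite /th; have := sqr_ge0 e; lra.
have s20 : 0 < s ^+ 2 by rewrite exprn_gt0.
have a20 : 0 < a ^+ 2 by rewrite exprn_gt0.
have eh1_le : e * h1 <= 0 by rewrite mulr_ge0_le0 // ltW.
have eh1_ge : 0 <= e * h1 + 2 * e.
  have : 0 <= e * (h1 + 2) by rewrite mulr_ge0 ?(ltW e0) //; lra.
  nra.
have [y yE] : exists y : R, y = e * h1 by exists (e * h1).
rewrite -yE in eh1_ge eh1_le aE.
have a2 : th * s ^+ 2 <= a ^+ 2.
  have [pe|pe] := leP 0 (p + y).
    have : s ^+ 2 <= a ^+ 2.
      have : y * (p + y) <= 0 by rewrite mulr_le0_ge0.
      have : y * p <= 0 by rewrite mulr_le0_ge0 // ltW.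
      by rewrite aE sE; nra.
    by apply: le_trans; rewrite ger_pMl.
  have : th <= a ^+ 2.
    have : 0 <= (2 * e - (p + y)) * (2 * e + (p + y)).
      by rewrite mulr_ge0 //; lra.
    by rewrite aE /th; nra.
  by apply: le_trans; rewrite ger_pMr // expr_le1 // ltW.
have as_ : th * s <= a.
  rewrite -(@ler_pXn2r _ 2) ?nnegrE ?mulr_ge0 ?(ltW a0) ?(ltW s0) ?(ltW th0) //.
  apply: le_trans a2; rewrite exprMn ler_wpM2r ?(ltW s20) //.
  by rewrite expr2 ger_pMr.
have eh0 : 0 <= e * h by rewrite mulr_ge0 // ltW.
rewrite -(@ltr_pM2r _ (a ^+ 2)^-1) ?invr_gt0 //.
have -> : (q + e * h2 + k * a ^+ 2 / (f + e * h)) / a ^+ 2 =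
    (q + e * h2) / a ^+ 2 + k / (f + e * h).
  by field; rewrite !gt_eqF // ltr_wpDr.
have -> : (k + 1) * (1 + 16 * e) * a ^+ 3 / a ^+ 2 = (k + 1) * (1 + 16 * e) * a.
  by field; rewrite gt_eqF.
have b1 : (q + e * h2) / a ^+ 2 <= (q + e * h2) / s ^+ 2 / th.
  rewrite -mulrA -invfM mulrC [leRHS]mulrC ler_wpM2r //.
    by rewrite addr_ge0 ?(ltW q0) // mulr_ge0 // ltW.
  by rewrite lef_pV2 ?posrE ?mulr_gt0 // mulrC.
have b2 : k / (f + e * h) <= k / f / th.
  rewrite -mulrA -invfM ler_wpM2l ?(le_trans ler01) //.
  have fe0 : 0 < f + e * h by rewrite ltr_wpDr.
  rewrite lef_pV2 ?posrE ?mulr_gt0 //.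
  by apply: (@le_trans _ _ f); [rewrite ger_pMr|rewrite lerDl].
have b3 : (q + e * h2) / s ^+ 2 / th + k / f / th <= ((k + 1) + 8 * e) * s / th.
  rewrite -mulrDl ler_wpM2r ?invr_ge0 ?(ltW th0) // mulrDl -addrA.
  rewrite [_ + k / f]addrC addrA ode' [leRHS]mulrDl lerD2l.
  rewrite ler_pdivrMr // -!mulrA.
  by rewrite [8 * _]mulrCA -exprS ler_pM2l // mulrC.
apply: (le_lt_trans (lerD b1 b2)); apply: (le_lt_trans b3).
apply: lt_le_trans (_ : (k + 1) * (1 + 16 * e) * (th * s) <= _); last first.
  rewrite ler_pM2l // mulr_gt0 //.
    by rewrite (lt_le_trans ltr01) // lerDr (le_trans ler01).
  by rewrite ltr_wpDr // mulr_ge0 // ltW.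
rewrite ltr_pdivrMr //.
have -> : (k + 1) * (1 + 16 * e) * (th * s) * th =
  (k + 1) * ((1 + 16 * e) * th ^+ 2) * s by ring.
rewrite ltr_pM2r //.
(* As [k >= 1], the left side is at least [k + 1 + 8 e]. *)
have : (k + 1) * (1 + 4 * e) < (k + 1) * ((1 + 16 * e) * th ^+ 2).
  rewrite ltr_pM2l; last by lra.
  have : 1 - 8 * e ^+ 2 <= th ^+ 2 by rewrite /th; nra.
  by nra.
by nra.
Qed.

(** For [e < 0] the slope increases and the profile decreases, so the terms in [q] and [k] only
    grow. The single loss, [e h2 / a^2], is at least [16 e s] because [a^2 >= s^2 / 2]; the dilation
    gains [16 (k + 1) |e| s], at least twice as much. *)
Lemma perturbation_subsolution k f p q s h (h1 h2 : R) e a (k1 : 1 <= k)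
    (f0 : 0 < f) (h0 : 0 <= h) (s0 : 0 < s) (p0 : 0 < p) (q0 : 0 < q)
    (sE : s ^+ 2 = 1 - p ^+ 2) (ode : q + k * s ^+ 2 / f = (k + 1) * s ^+ 3)
    (h2_le : h2 <= 8 * s ^+ 3) (h1_le0 : h1 <= 0) (h1_ge : - 2 <= h1)
    (h1_ge' : - (8 * s ^+ 2) <= h1) (a0 : 0 < a) :
  0 < - e <= 64^-1 -> 0 < f + e * h ->
  a ^+ 2 = 1 - (p + e * h1) ^+ 2 ->
  (k + 1) * (1 + 16 * e) * a ^+ 3 < q + e * h2 + k * a ^+ 2 / (f + e * h).
Proof.
move=> /andP[]; rewrite oppr_gt0 => e0 e64 g0 aE.
have e64' : - e <= 1 / 64 by rewrite div1r.
have ode' := profile_ode_div f0 s0 ode.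
have s20 : 0 < s ^+ 2 by rewrite exprn_gt0.
have a20 : 0 < a ^+ 2 by rewrite exprn_gt0.
have p1 : p <= 1.
  have : p ^+ 2 <= 1 by rewrite -subr_ge0 -sE ltW.
  by nra.
have eh1_ge : 0 <= e * h1 by rewrite mulr_le0 // ltW.
have e1 : 0 <= (e + 1 / 64) * - h1 by rewrite mulr_ge0 //; lra.
have eh1_le : e * h1 <= s ^+ 2 / 8 by nra.
have eh1_le' : e * h1 <= 1 / 32 by nra.
have [y yE] : exists y : R, y = e * h1 by exists (e * h1).
rewrite -yE in eh1_ge eh1_le eh1_le' aE.
have py : 0 <= p * y by rewrite mulr_ge0 // ltW.
have py1 : p * y <= y by rewrite ler_piMl.
have yy : y ^+ 2 <= y / 32 by rewrite expr2 ler_wpM2l // -div1r.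
have a2s : a ^+ 2 <= s ^+ 2.
  by rewrite aE sE; have := sqr_ge0 y; nra.
have a2 : s ^+ 2 / 2 <= a ^+ 2.
  have -> : a ^+ 2 = s ^+ 2 - 2 * (p * y) - y ^+ 2 by rewrite aE sE; ring.
  lra.
have as_ : a <= s.
  by rewrite -(@ler_pXn2r _ 2) ?nnegrE ?(ltW a0) ?(ltW s0).
rewrite -(@ltr_pM2r _ (a ^+ 2)^-1) ?invr_gt0 //.
have -> : (q + e * h2 + k * a ^+ 2 / (f + e * h)) / a ^+ 2 =
    q / a ^+ 2 + k / (f + e * h) + e * h2 / a ^+ 2.
  by field; rewrite !gt_eqF.
have -> : (k + 1) * (1 + 16 * e) * a ^+ 3 / a ^+ 2 = (k + 1) * (1 + 16 * e) * a.
  by field; rewrite gt_eqF.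
have b1 : q / s ^+ 2 <= q / a ^+ 2.
  by rewrite ler_pM2l // lef_pV2 ?posrE.
have b2 : k / f <= k / (f + e * h).
  rewrite ler_wpM2l ?(le_trans ler01) // lef_pV2 ?posrE //.
  by rewrite gerDl mulr_le0_ge0 // ltW.
have b3 : 16 * e * s <= e * h2 / a ^+ 2.
  rewrite ler_pdivlMr // -subr_ge0.
  have -> : e * h2 - 16 * e * s * a ^+ 2 = (- e) * (16 * s * a ^+ 2 - h2).
    by ring.
  rewrite mulr_ge0 //; first by lra.
  rewrite subr_ge0 (le_trans h2_le) //.
  have -> : 8 * s ^+ 3 = 16 * s * (s ^+ 2 / 2) by field.
  by rewrite ler_pM2l // mulr_gt0.
apply: lt_le_trans (lerD (lerD b1 b2) b3); rewrite ode'.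
apply: (@le_lt_trans _ _ ((k + 1) * (1 + 16 * e) * s)).
  by rewrite ler_wpM2l // mulr_ge0 //; lra.
have -> : (k + 1) * (1 + 16 * e) * s = (k + 1) * s + (k + 1) * (16 * e * s).
  by ring.
by rewrite ltrD2l -subr_gt0 -[X in _ < X - _]mul1r -mulrBl nmulr_rgt0; nra.
Qed.

End PerturbationAlgebra.

(** * The gap between the hyperbola and its asymptote *)

Section Gap.
Context {R : realType}.
Implicit Types t : R.

(* [gap] is unbounded at [-oo] while [gap2] decays like [(1 + t^2)^(-3/2)]; for
   the profile [f] one has [1 - f'^2 >= 1 / (4 f^2) >= 1 / (4 (1 + t^2))], so
   adding a multiple of [gap] stays harmless at [+oo], where [f'] tends to 1. *)
Definition gap t : R := Num.sqrt (1 + t ^+ 2) - t.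
Definition gap1 t : R := t / Num.sqrt (1 + t ^+ 2) - 1.
Definition gap2 t : R := Num.sqrt (1 + t ^+ 2) ^- 3.

Lemma hyperbola_sqr t : Num.sqrt (1 + t ^+ 2) ^+ 2 = 1 + t ^+ 2.
Proof. by rewrite sqr_sqrtr // addr_ge0 ?sqr_ge0. Qed.

Lemma hyperbola_gt t : `|t| < Num.sqrt (1 + t ^+ 2).
Proof.
rewrite -(@ltr_pXn2r _ 2) ?nnegrE ?sqrtr_ge0 // hyperbola_sqr.
by rewrite real_normK ?num_real // ltrDr.
Qed.

Lemma hyperbola_gt0 t : 0 < Num.sqrt (1 + t ^+ 2).
Proof. exact: le_lt_trans (hyperbola_gt t). Qed.

Lemma gap_gt0 t : 0 < gap t.
Proof. by rewrite subr_gt0 (le_lt_trans _ (hyperbola_gt t)) ?ler_norm. Qed.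

Lemma gap_ge t : - t <= gap t.
Proof. by rewrite lerDr sqrtr_ge0. Qed.

Lemma gap_derive t : is_derive t (1 : R) gap (gap1 t).
Proof.
have pos : 0 < 1 + t ^+ 2 by rewrite ltr_pwDl ?sqr_ge0.
have sq : is_derive t (1 : R) (fun t => 1 + t ^+ 2) (2 * t).
  apply: (is_derive_eq (derive_add (derive_constant 1 t)
    (derive_sqr (derive_identity t)))).
  by ring.
apply: (is_derive_eq (derive_add
  (derive_comp (g := fun t => 1 + t ^+ 2) (is_derive1_sqrt pos) sq)
  (derive_opp (derive_identity t)))).
by rewrite /gap1; field; rewrite gt_eqF ?hyperbola_gt0.
Qed.

Lemma gap1_derive t : is_derive t (1 : R) gap1 (gap2 t).
Proof.
have pos : 0 < 1 + t ^+ 2 by rewrite ltr_pwDl ?sqr_ge0.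
have sq : is_derive t (1 : R) (fun t => 1 + t ^+ 2) (2 * t).
  apply: (is_derive_eq (derive_add (derive_constant 1 t)
    (derive_sqr (derive_identity t)))).
  by ring.
have S0 : Num.sqrt (1 + t ^+ 2) != 0 by rewrite gt_eqF ?hyperbola_gt0.
apply: (is_derive_eq (derive_add (derive_mul (derive_identity t)
  (derive_inv (f := fun t => Num.sqrt (1 + t ^+ 2)) S0
    (derive_comp (g := fun t => 1 + t ^+ 2) (is_derive1_sqrt pos) sq)))
  (derive_constant (- 1) t))).
rewrite /gap2; set S := Num.sqrt _ in S0 *.
have -> : t * (- (S ^- 2) * ((2 * S)^-1 * (2 * t))) + S^-1 * 1 + 0 =
    (S ^+ 2 - t ^+ 2) / S ^+ 3 by field.
by rewrite /S hyperbola_sqr addrK mul1r.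
Qed.

Lemma gap1_le0 t : gap1 t <= 0.
Proof.
rewrite subr_le0 ler_pdivrMr ?hyperbola_gt0 // mul1r.
by rewrite (le_trans (ler_norm t)) // ltW ?hyperbola_gt.
Qed.

Lemma gap1_ge t : - 2 <= gap1 t.
Proof.
have : - 1 <= t / Num.sqrt (1 + t ^+ 2).
  rewrite ler_pdivlMr ?hyperbola_gt0 // mulN1r lerNl.
  by rewrite (le_trans _ (ltW (hyperbola_gt t))) // -normrN ler_norm.
by rewrite /gap1; lra.
Qed.

(** With [S = sqrt (1 + t^2)], [1 - t / S = S (S - t) / S^2], and [S (S - t) <= S^2 - t^2 = 1] since
    [0 <= t <= S]. *)
Lemma gap1_ge_right t : 0 <= t -> - (Num.sqrt (1 + t ^+ 2) ^- 2) <= gap1 t.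
Proof.
move=> t0; have S0 := hyperbola_gt0 t; have S2 := hyperbola_sqr t.
rewrite /gap1; set S := Num.sqrt _ in S0 S2 *.
have -> : t / S - 1 = - ((S * (S - t)) / S ^+ 2) by field; rewrite gt_eqF.
rewrite lerN2 ler_pdivrMr ?exprn_gt0 // mulVf ?expf_neq0 ?gt_eqF //.
have tS : t <= S by rewrite (le_trans (ler_norm t)) // ltW ?hyperbola_gt.
have : 0 <= t * (S - t) by rewrite mulr_ge0 ?subr_ge0.
by nra.
Qed.

End Gap.

(** * Estimates for the profile and its perturbations *)

Section ProfileTheory.
Context {R : realType} {m : nat}.
Variable f : R -> R.
Hypotheses (m0 : (0 < m)%N) (hf : semitrough_profile m.+1 f).

Let f' := derive1 f.
Let f'' := derive1n 2 f.
Let s t := Num.sqrt (1 - f' t ^+ 2).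

Lemma profile_is_derive t : is_derive t (1 : R) f (f' t).
Proof.
split; first exact: profile_derivable hf t.
by rewrite /f' derive1E.
Qed.

Lemma profile_is_derive2 t : is_derive t (1 : R) f' (f'' t).
Proof.
split; first exact: profile_derivable2 hf t.
by rewrite /f'' derive1nS derive1n1 derive1E.
Qed.

Lemma profile_max t : Num.max (m%:R / m.+1%:R) t < f t.
Proof.
have /andP[+ _] := profile_bounds hf t.
by rewrite -[in X in X - 1]natr1 addrK.
Qed.

Lemma profile_gt0 t : 0 < f t.
Proof.
apply: le_lt_trans (profile_max t).
by rewrite le_max divr_ge0.
Qed.

Lemma profile_gt t : t < f t.
Proof. by apply: le_lt_trans (profile_max t); rewrite le_max lexx orbT. Qed.

Lemma profile_lt t : f t < Num.sqrt (1 + t ^+ 2).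
Proof. by have /andP[] := profile_bounds hf t. Qed.

Lemma profile_sqr_lt t : f t ^+ 2 < 1 + t ^+ 2.
Proof.
rewrite -hyperbola_sqr ltr_pXn2r ?nnegrE ?sqrtr_ge0 ?profile_lt //.
exact/ltW/profile_gt0.
Qed.

Lemma profile_lt1 t : t <= 0 -> f t < 1.
Proof.
move=> t0; have f01 : f 0 < 1.
  by have := profile_lt 0; rewrite expr0n addr0 sqrtr1.
apply: le_lt_trans f01; rewrite -subr_ge0.
have [c _ ->] := mean_value profile_is_derive t 0.
rewrite mulr_ge0 ?subr_ge0 //.
by have /andP[/ltW] := profile_deriv_bounds hf c.
Qed.

Lemma slope_defect_gt0 t : 0 < 1 - f' t ^+ 2.
Proof.
have /andP[p0 p1] := profile_deriv_bounds hf t.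
by rewrite subr_gt0 expr_lt1 // ltW.
Qed.

Lemma slope_defect_sqr t : s t ^+ 2 = 1 - f' t ^+ 2.
Proof. by rewrite sqr_sqrtr // ltW ?slope_defect_gt0. Qed.

Lemma slope_gt0 t : 0 < s t.
Proof. by rewrite sqrtr_gt0 slope_defect_gt0. Qed.

Lemma profile_ode_polynomial t :
  f'' t + m%:R * s t ^+ 2 / f t = (m%:R + 1) * s t ^+ 3.
Proof.
have := profile_ode hf t.
rewrite -/f'' -/f' -[in X in X - 1]natr1 addrK.
have -> : (1 - f' t ^+ 2) `^ (1 / 2) = s t.
  by rewrite div1r powR12_sqrt // ltW ?slope_defect_gt0.
have -> : (1 - f' t ^+ 2) `^ (3 / 2) = s t ^+ 3.
  rewrite mulrC powRrM powR12_sqrt ?(ltW (slope_defect_gt0 t)) //.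
  by rewrite powR_mulrn ?sqrtr_ge0.
rewrite natr1 => <-; field.
by rewrite !gt_eqF ?slope_gt0 ?profile_gt0.
Qed.

(** Dropping the positive term [f''] from the equation leaves [f s >= m / (m + 1) >= 1 / 2]. *)
Lemma profile_slope_lower t : 1 <= 2 * (f t * s t).
Proof.
have f0 := profile_gt0 t; have s0 := slope_gt0 t.
have q0 := profile_convex hf t.
have k1 : 1 <= m%:R :> R by rewrite ler1n.
have ode := profile_ode_div f0 s0 (profile_ode_polynomial t).
have : m%:R / f t <= (m%:R + 1) * s t.
  by rewrite -ode lerDr divr_ge0 ?sqr_ge0 // ltW.
rewrite ler_pdivrMr // -mulrA [s t * _]mulrC => le1.
by nra.
Qed.

Lemma gap2_ge0 t : 0 <= gap2 t :> R.
Proof. by rewrite invr_ge0 exprn_ge0 ?sqrtr_ge0. Qed.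

Lemma hyperbola_inv_le t : (Num.sqrt (1 + t ^+ 2))^-1 <= 2 * s t.
Proof.
rewrite -[leLHS]mul1r ler_pdivrMr ?hyperbola_gt0 //.
apply: le_trans (profile_slope_lower t) _.
rewrite -mulrA ler_pM2l // mulrC ler_pM2l ?slope_gt0 //.
exact/ltW/profile_lt.
Qed.

Lemma gap2_le t : gap2 t <= 8 * s t ^+ 3.
Proof.
have -> : 8 * s t ^+ 3 = (2 * s t) ^+ 3 by ring.
rewrite /gap2 -exprVn.
rewrite ler_pXn2r ?nnegrE ?invr_ge0 ?sqrtr_ge0 ?hyperbola_inv_le //.
by rewrite mulr_ge0 // ltW ?slope_gt0.
Qed.

(** On the right, [gap1] decays like [1 / (1 + t^2)], which is at most [4 s^2]. On the left, [f < 1]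
    forces [s >= 1 / 2], and [gap1 >= - 2] suffices. *)
Lemma gap1_ge_slope t : - (8 * s t ^+ 2) <= gap1 t.
Proof.
have [t0|t0] := leP 0 t.
  apply: le_trans (gap1_ge_right t0); rewrite lerN2 -exprVn.
  apply: (@le_trans _ _ ((2 * s t) ^+ 2)).
    rewrite ler_pXn2r ?nnegrE ?invr_ge0 ?sqrtr_ge0 ?hyperbola_inv_le //.
    by rewrite mulr_ge0 // ltW ?slope_gt0.
  by have := sqr_ge0 (s t); nra.
apply: le_trans (gap1_ge t).
have := profile_slope_lower t; have := profile_lt1 (ltW t0).
have := profile_gt0 t; have := slope_gt0 t => s0 f0 f1 fs.
have : 1 <= 2 * s t.
  by apply: le_trans fs _; rewrite ler_pM2l // ler_piMl // ltW.
by nra.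
Qed.

Definition perturbed (e t : R) : R :=
  let l := 1 + 16 * e in l * (f (t / l) + e * gap (t / l)).

Definition perturbed1 (e t : R) : R :=
  let l := 1 + 16 * e in f' (t / l) + e * gap1 (t / l).

Definition perturbed2 (e t : R) : R :=
  let l := 1 + 16 * e in (f'' (t / l) + e * gap2 (t / l)) / l.

Section Fixed_e.
Variable e : R.
Hypothesis l0 : 0 < 1 + 16 * e.
Let l := 1 + 16 * e.

Let scale_derive t : is_derive t (1 : R) (fun t => t / l) l^-1.
Proof.
apply: (is_derive_eq (derive_mul (derive_identity t) (derive_constant l^-1 t))).
by ring.
Qed.

Lemma perturbed_derive t : is_derive t (1 : R) (perturbed e) (perturbed1 e t).
Proof.
apply: (is_derive_eq (derive_mul (derive_constant l t)
  (derive_add (derive_comp (profile_is_derive _) (scale_derive t))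
    (derive_mul (derive_constant e t)
      (derive_comp (gap_derive _) (scale_derive t)))))).
by rewrite /perturbed1 -/l; field; rewrite gt_eqF.
Qed.

Lemma perturbed1_derive t :
  is_derive t (1 : R) (perturbed1 e) (perturbed2 e t).
Proof.
apply: (is_derive_eq (derive_add
  (derive_comp (profile_is_derive2 _) (scale_derive t))
  (derive_mul (derive_constant e t)
    (derive_comp (gap1_derive _) (scale_derive t))))).
by rewrite /perturbed2 -/l; field; rewrite gt_eqF.
Qed.

Section AtPoint.
Variable t : R.
Hypothesis defect : 0 < 1 - perturbed1 e t ^+ 2.
Let a := Num.sqrt (1 - perturbed1 e t ^+ 2).

Let a0 : 0 < a. Proof. by rewrite sqrtr_gt0. Qed.

Let aE : a ^+ 2 = 1 - perturbed1 e t ^+ 2.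
Proof. by rewrite sqr_sqrtr // ltW. Qed.

Let k1 : 1 <= m%:R :> R. Proof. by rewrite ler1n. Qed.

Let slope_pos : 0 < f' (t / l).
Proof. by have /andP[] := profile_deriv_bounds hf (t / l). Qed.

(** The dilation divides the curvature expression by [l]; moved to the other side, [l] becomes the
    factor [1 + 16 e] of the algebraic lemmas. *)
Let mean_curvature_scaled : f (t / l) + e * gap (t / l) != 0 ->
  perturbed2 e t + m%:R * a ^+ 2 / perturbed e t =
  (f'' (t / l) + e * gap2 (t / l) +
    m%:R * a ^+ 2 / (f (t / l) + e * gap (t / l))) / l.
Proof.
by move=> g0; rewrite /perturbed2 /perturbed -/l; field; rewrite g0 gt_eqF.
Qed.

Lemma perturbed_supersolution : 0 < e <= 64^-1 ->
  perturbed2 e t + m%:R * a ^+ 2 / perturbed e t < m.+1%:R * a ^+ 3.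
Proof.
move=> e64; have e0 : 0 < e by case/andP: e64.
have g0 : 0 < f (t / l) + e * gap (t / l).
  by rewrite addr_gt0 ?profile_gt0 // mulr_gt0 ?gap_gt0.
rewrite mean_curvature_scaled ?gt_eqF // ltr_pdivrMr // -natr1.
rewrite [ltRHS]mulrAC.
exact: (perturbation_supersolution k1 (profile_gt0 _) (ltW (gap_gt0 _))
  (slope_gt0 _) slope_pos (profile_convex hf _) (slope_defect_sqr _)
  (profile_ode_polynomial _) (gap2_le _) (gap1_le0 _) (gap1_ge _)
  (gap2_ge0 _) a0 e64 aE).
Qed.

Lemma perturbed_subsolution : 0 < - e <= 64^-1 -> 0 < perturbed e t ->
  m.+1%:R * a ^+ 3 < perturbed2 e t + m%:R * a ^+ 2 / perturbed e t.
Proof.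
move=> e64; rewrite /perturbed -/l pmulr_rgt0 // => g0.
rewrite mean_curvature_scaled ?gt_eqF // ltr_pdivlMr // -natr1.
rewrite [ltLHS]mulrAC.
exact: (perturbation_subsolution k1 (profile_gt0 _) (ltW (gap_gt0 _))
  (slope_gt0 _) slope_pos (profile_convex hf _) (slope_defect_sqr _)
  (profile_ode_polynomial _) (gap2_le _) (gap1_le0 _) (gap1_ge _)
  (gap1_ge_slope _) a0 e64 g0 aE).
Qed.

End AtPoint.
End Fixed_e.

Lemma perturbed0 t : perturbed 0 t = f t.
Proof. by rewrite /perturbed mulr0 addr0 divr1 mul1r mul0r addr0. Qed.

Lemma perturbed_continuous t :
  {for (0 : R), continuous (fun e : R => perturbed e t)}.
Proof.
apply: differentiable_continuous; apply/derivable1_diffP.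
have ld e : is_derive e (1 : R) (fun e => 1 + 16 * e) 16.
  apply: (is_derive_eq (derive_add (derive_constant 1 e)
    (derive_mul (derive_constant 16 e) (derive_identity e)))).
  by ring.
have l0 : 1 + 16 * (0 : R) != 0 by rewrite mulr0 addr0 oner_neq0.
have td := derive_mul (derive_constant t 0)
  (derive_inv (f := fun e => 1 + 16 * e) l0 (ld 0)).
have := derive_mul (ld 0) (derive_add (derive_comp (profile_is_derive _) td)
  (derive_mul (derive_identity 0) (derive_comp (gap_derive _) td))).
by case.
Qed.

End ProfileTheory.

(** * Comparison *)

Section GlobalComparison.
Context {R : realType}.

(** The maximum over a cube containing the superlevel set of [w y] is global, since outside this set
    [w] is below [w y]. *)
Lemma global_max n (w : 'rV[R]_n -> R) y M : continuous w ->
  (forall x, w y <= w x -> forall i, `|x 0 i| <= M) ->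
  exists x, forall z, w z <= w x.
Proof.
move=> wc bounded_above.
pose A : set 'rV[R]_n := [set v | forall i, `[- M, M]%classic (v ord0 i)].
have inA x : w y <= w x -> A x.
  by move=> wx i; rewrite /= in_itv /= -ler_norml; exact: bounded_above.
have cA : compact A.
  apply: (@rV_compact _ n (fun=> `[- M, M]%classic)) => _.
  exact: segment_compact.
have A0 : A !=set0 by exists y; exact: inA.
have [x _ xmax] := EVT_max_rV A0 cA (continuous_subspaceT wc).
exists x => z.
have [zy|yz] := leP (w z) (w y).
  by apply: le_trans zy _; apply: xmax; rewrite inE; exact: inA.
by apply: xmax; rewrite inE; apply: inA; exact: ltW.
Qed.

Context {m : nat}.
Implicit Types (x y : 'rV[R]_m.+1) (g f : R -> R).

Lemma semitrough_continuous g : continuous g ->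
  continuous (semitrough g : 'rV[R]_m.+1 -> R).
Proof.
move=> gc x.
have x1c i : {for x, continuous (fun z : 'rV[R]_m.+1 => z 0 i)}.
  exact: coord_continuous.
have sq (h : 'rV[R]_m.+1 -> R) :
    {for x, continuous h} -> {for x, continuous (fun z => h z ^+ 2)}.
  by move=> hc; exact: (continuousM hc hc).
apply: continuous_comp; last exact: sqrt_continuous.
apply: (@continuousD _ _ _ (fun z => g (x1 z) ^+ 2)).
  apply: sq; apply: (@continuous_comp _ _ _ (@x1 R m) g); first exact: x1c.
  exact: gc.
have -> : (fun z : 'rV[R]_m.+1 => enorm (xbar z) ^+ 2) =
    \sum_(j < m) (fun z : 'rV[R]_m.+1 => z 0 (lift ord0 j) ^+ 2).
  apply/funext => z; rewrite fct_sumE enorm_sqr; apply: eq_bigr => j _.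
  by rewrite mxE expr2.
apply: (big_ind (fun h : 'rV[R]_m.+1 -> R => {for x, continuous h})).
- exact: cst_continuous.
- by move=> h k hc kc; exact: continuousD.
- by move=> j _; exact: sq.
Qed.

Lemma coord_bound x a b : `|x1 x| <= a -> enorm (xbar x) <= b ->
  forall i, `|x 0 i| <= a + b.
Proof.
move=> xa xb i; have b0 : 0 <= b := le_trans (enorm_ge0 _) xb.
have a0 : 0 <= a := le_trans (normr_ge0 _) xa.
case: (unliftP ord0 i) => [j|] ->; last by rewrite (le_trans xa) // lerDl.
have := normr_coord_le_enorm (xbar x) j; rewrite mxE => /le_trans; apply.
by rewrite (le_trans xb) // lerDr.
Qed.

Lemma V_le_semitrough g x :
  x1 x <= g (x1 x) -> V_half_sphere x <= semitrough g x.
Proof.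
move=> gx; have [x0|x0] := leP 0 (x1 x).
  apply: le_trans (V_le_enorm x) _.
  rewrite -(@ler_pXn2r _ 2) ?nnegrE ?enorm_ge0 ?sqrtr_ge0 //.
  rewrite semitrough_sqr enorm_split lerD2r ler_pXn2r ?nnegrE //.
  exact: le_trans gx.
apply: le_trans (V_le_enorm_xbar (ltW x0)) _.
rewrite -(@ler_pXn2r _ 2) ?nnegrE ?enorm_ge0 ?sqrtr_ge0 //.
by rewrite semitrough_sqr lerDr sqr_ge0.
Qed.

(** * Comparison with the perturbed semitroughs *)

Section Comparison.
Variables (f : R -> R) (u : 'rV[R]_m.+1 -> R).
Hypotheses (m0 : (0 < m)%N) (hf : semitrough_profile m.+1 f).
Hypotheses (u_smooth : smooth u) (u_spacelike : spacelike u).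
Hypothesis u_sigma1 : forall x, exists kappa,
  principal_curvatures u x kappa /\ sigma1 kappa = m.+1%:R.
Hypothesis V_le_u : forall x, V_half_sphere x <= u x.

Let u_continuous : continuous u := (u_smooth [::]).1.

Let perturbed_cont e : 0 < 1 + 16 * e -> continuous (perturbed f e).
Proof.
move=> l0 t; apply: differentiable_continuous; apply/derivable1_diffP.
exact: (@ex_derive _ _ _ _ _ _ _ (perturbed_derive hf l0 t)).
Qed.

(** The bound by [t] keeps the semitrough above [V]; the bound by [- (e * t)] is the linear growth
    at [-oo]. *)
Lemma perturbed_ge e t : 0 < e -> Num.max t (- (e * t)) <= perturbed f e t.
Proof.
move=> e0; have l0 : 0 < 1 + 16 * e by rewrite ltr_pwDl // mulr_ge0 // ltW.
have l1 : 1 <= 1 + 16 * e by rewrite lerDl mulr_ge0 // ltW.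
rewrite /perturbed; set l := 1 + 16 * e in l0 l1 *.
have tl : t = l * (t / l) by rewrite mulrC divfK // gt_eqF.
have g0 : 0 <= e * gap (t / l) by rewrite mulr_ge0 // ltW ?gap_gt0.
rewrite ge_max {1}tl ler_pM2l // (le_trans (ltW (profile_gt hf _))) ?lerDl //=.
rewrite {1}tl mulrCA -mulrN ler_pM2l // -mulrN.
apply: (@le_trans _ _ (e * gap (t / l))); first by rewrite ler_pM2l // gap_ge.
by rewrite lerDr ltW ?(profile_gt0 hf).
Qed.

Lemma perturbed_gt0 e t : 0 < e -> 0 < perturbed f e t.
Proof.
move=> e0; rewrite mulr_gt0 ?ltr_pwDl ?mulr_ge0 ?(ltW e0) //.
  exact: profile_gt0 hf _.
exact/ltW/gap_gt0.
Qed.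

Hypothesis u_far : forall e : R, 0 < e -> exists M : R,
  forall x, M < x1 x \/ M < enorm (xbar x) -> u x <= V_half_sphere x + e.
Hypothesis u_bounded : exists C0 : R, forall x, `|u x - V_half_sphere x| <= C0.

Lemma u_le_perturbed e y :
  0 < e <= 64^-1 -> u y <= semitrough (perturbed f e) y.
Proof.
move=> e64; have e0 : 0 < e by case/andP: e64.
have l0 : 0 < 1 + 16 * e by rewrite ltr_pwDl // mulr_ge0 // ltW.
rewrite leNgt; apply/negP => y_above.
pose w x := u x - semitrough (perturbed f e) x.
have wy : 0 < w y by rewrite subr_gt0.
have Vv x : V_half_sphere x <= semitrough (perturbed f e) x.
  apply: V_le_semitrough; apply: le_trans (perturbed_ge (x1 x) e0).
  by rewrite le_max lexx.
have wy2 : 0 < w y / 2 by rewrite divr_gt0.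
have [M far] := u_far wy2.
have [C bounded] := u_bounded.
(* Where [r <= M] and the semitrough is at most [r + |C|], the squared profile is at most
   [(r + |C|)^2 - r^2 <= B]; its linear growth then bounds [x1] from below. *)
pose B := 2 * `|M| * `|C| + `|C| ^+ 2.
have B0 : 0 <= B by rewrite addr_ge0 ?sqr_ge0 // !mulr_ge0.
have wc : continuous w.
  move=> x; apply: (@continuousB _ _ _ u); first exact: u_continuous.
  exact: semitrough_continuous (perturbed_cont l0) _.
have [x0 x0max] : exists x, forall z, w z <= w x.
  apply: (@global_max _ w y (`|M| + (B + 1) / e + `|M|) wc) => x wx.
  have [x1M rM] : x1 x <= M /\ enorm (xbar x) <= M.
    (* Otherwise [V <= semitrough] would give [w x <= w y / 2]. *)
    have near_V : ~ u x <= V_half_sphere x + w y / 2.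
      by have := Vv x; move: wx; rewrite {2}/w; lra.
    split; rewrite leNgt; apply/negP => h; apply: near_V; apply: far.
      by left.
    by right.
  have r0 := enorm_ge0 (xbar x).
  have M0 : `|M| = M by rewrite ger0_norm // (le_trans r0).
  apply: coord_bound; last by rewrite M0.
  have B1 : 0 <= (B + 1) / e by rewrite divr_ge0 ?addr_ge0 // ltW.
  have [x1pos|x1neg] := leP 0 (x1 x); first by rewrite ger0_norm // M0; lra.
  rewrite ler0_norm ?(ltW x1neg) //.
  apply: (@le_trans _ _ ((B + 1) / e)); last by rewrite lerDr.
  rewrite ler_pdivlMr //.
  have : - (e * x1 x) <= perturbed f e (x1 x).
    by apply: le_trans (perturbed_ge (x1 x) e0); rewrite le_max lexx orbT.
  have v_le : semitrough (perturbed f e) x <= enorm (xbar x) + `|C|.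
    have := bounded x; rewrite ler_norml => /andP[_ uC].
    have := V_le_enorm_xbar (ltW x1neg).
    by have := ler_norm C; move: wx; rewrite {2}/w; lra.
  have : perturbed f e (x1 x) ^+ 2 <= B.
    have := semitrough_sqr (perturbed f e) x.
    have C0 := normr_ge0 C.
    have : semitrough (perturbed f e) x ^+ 2 <= (enorm (xbar x) + `|C|) ^+ 2.
      by rewrite ler_pXn2r ?nnegrE ?sqrtr_ge0 ?addr_ge0.
    have : enorm (xbar x) * `|C| <= `|M| * `|C| by rewrite ler_wpM2r // M0.
    by rewrite /B; nra.
  set g := perturbed f e (x1 x) => gB egx.
  have : g <= B + 1 by have := sqr_ge0 (g - 1); nra.
  lra.
have [| |defect] := contact_curvature u_smooth (oner_neq0 R)
   (perturbed_derive hf l0) (perturbed1_derive hf l0 (x1 x0)) _ _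
   u_spacelike (u_sigma1 x0).
- exact: perturbed_gt0.
- by move=> d; apply: filterE => t; rewrite !mul1r; exact: x0max.
rewrite mul1r subr_le0 leNgt => /negP; apply.
exact: perturbed_supersolution.
Qed.

(** With [T = t / l] and [l <= 1], the value is at most [l * f T], and [f T ^+ 2 < 1 + T ^+ 2], or
    [f T < 1] if [T < 0]. Positivity on the left forces [- e * gap T < 1], and [gap T >= - T]. *)
Lemma perturbed_neg_bound e t : 0 < - e <= 64^-1 -> 0 < perturbed f e t ->
  perturbed f e t ^+ 2 <= 1 + Num.max t 0 ^+ 2 /\ - (- e)^-1 <= t.
Proof.
move=> /andP[ne0 e64] g0.
have e0 : e < 0 by rewrite -oppr_gt0.
have l0 : 0 < 1 + 16 * e by have : - e <= 1 / 64 by [rewrite div1r]; lra.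
have l1 : 1 + 16 * e <= 1 by lra.
move: g0; rewrite /perturbed; set l := 1 + 16 * e in l0 l1 *.
set T := t / l; have tE : t = l * T by rewrite mulrC divfK // gt_eqF.
rewrite pmulr_rgt0 // => g0.
have gf : f T + e * gap T <= f T by rewrite gerDl mulr_le0_ge0 // ltW ?gap_gt0.
have l21 : l ^+ 2 <= 1 by rewrite expr_le1 // ltW.
have gl : (l * (f T + e * gap T)) ^+ 2 <= l ^+ 2 * f T ^+ 2.
  rewrite exprMn ler_wpM2l ?sqr_ge0 // ler_pXn2r ?nnegrE ?(ltW g0) //.
  exact/ltW/(profile_gt0 hf).
have f0 := profile_gt0 hf T.
have [T0|T0] := leP 0 T.
  have t0 : 0 <= t by rewrite tE mulr_ge0 // ltW.
  rewrite max_l //; split; last first.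
    by rewrite (le_trans _ t0) // oppr_le0 invr_ge0 ltW.
  apply: le_trans gl _; rewrite {1}tE exprMn.
  have := profile_sqr_lt hf T => /ltW /(ler_wpM2l (sqr_ge0 l)) /le_trans; apply.
  by rewrite mulrDr mulr1 lerD2r.
have f1 := profile_lt1 hf (ltW T0).
have t0 : t <= 0 by rewrite tE mulr_ge0_le0 // ltW.
rewrite max_r //; split.
  rewrite expr0n addr0; apply: le_trans gl _.
  by rewrite mulr_ile1 ?sqr_ge0 // expr_le1 // ltW.
rewrite lerNl -[leRHS]mul1r ler_pdivlMr // {1}tE.
have X1 : - e * - T < 1.
  apply: le_lt_trans (_ : - e * gap T < 1); first by rewrite ler_pM2l // gap_ge.
  by move: g0; rewrite mulNr; lra.
have -> : - (l * T) * - e = l * (- e * - T) by ring.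
by rewrite mulr_ile1 ?(ltW l0) ?(ltW X1) // mulr_ge0 ?oppr_ge0 ?(ltW T0) // ltW.
Qed.

Lemma perturbed_le_u e y : 0 < - e <= 64^-1 -> 0 < perturbed f e (x1 y) ->
  semitrough (perturbed f e) y <= u y.
Proof.
move=> e64 gy; have ne0 : 0 < - e by case/andP: e64.
have l0 : 0 < 1 + 16 * e.
  have : - e <= 1 / 64 by rewrite div1r; case/andP: e64.
  by lra.
rewrite leNgt; apply/negP => y_below.
(* The truncation makes the comparison function global. Where it is active the semitrough is
   [enorm (xbar x) <= V <= u], so a positive maximum of [w] lies in the open region where [g] is the
   perturbed profile. *)
pose g t := Num.max (perturbed f e t) 0.
have g_pos t : 0 < perturbed f e t -> g t = perturbed f e t.
  by move=> g0; rewrite /g max_l // ltW.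
have semi_pos x : 0 < perturbed f e (x1 x) ->
    semitrough g x = semitrough (perturbed f e) x.
  by move=> g0; rewrite /semitrough g_pos.
pose w x := semitrough g x - u x.
have wy : 0 < w y by rewrite subr_gt0 semi_pos.
have gc : continuous g.
  move=> t; apply: (@continuous_max _ _ (perturbed f e) (fun=> 0)).
    exact: perturbed_cont.
  exact: cst_continuous.
have wc : continuous w.
  move=> x.
  apply: (@continuousB _ _ _ (semitrough g)); last exact: u_continuous.
  exact: semitrough_continuous gc _.
have w_pos x : 0 < w x -> 0 < perturbed f e (x1 x).
  move=> wx; rewrite ltNge; apply/negP => g0.
  have : semitrough g x <= u x.
    apply: le_trans (V_le_u x); apply: le_trans (enorm_xbar_le_V x m0).
    rewrite /semitrough /g max_r // expr0n add0r sqrtr_sqr ger0_norm //.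
    exact: enorm_ge0.
  by move: wx; rewrite /w; lra.
have [x0 x0max] : exists x, forall z, w z <= w x.
  have above := @global_max _ w y ((- e)^-1 + (2 * w y)^-1 + (2 * w y)^-1) wc.
  apply: above => x wx.
  have wx0 : 0 < w x by apply: lt_le_trans wx.
  have [gb xb] := perturbed_neg_bound e64 (w_pos x wx0).
  have e1 : 0 < (- e)^-1 by rewrite invr_gt0.
  have w1 : 0 < (2 * w y)^-1 by rewrite invr_gt0 mulr_gt0.
  (* Applied to [enorm x] or [enorm (xbar x)]: [(a + w y)^2 <= 1 + a^2] yields [2 a w y <= 1]. *)
  have key a : 0 <= a -> a <= V_half_sphere x ->
      perturbed f e (x1 x) ^+ 2 + enorm (xbar x) ^+ 2 <= 1 + a ^+ 2 ->
      a <= (2 * w y)^-1.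
    move=> a0 aV bound; rewrite -[leRHS]mul1r ler_pdivlMr ?mulr_gt0 //.
    have va : a + w y <= semitrough g x.
      by have := V_le_u x; move: wx; rewrite {2}/w; lra.
    have : (a + w y) ^+ 2 <= semitrough g x ^+ 2.
      rewrite ler_pXn2r ?nnegrE ?semitrough_ge0 //.
      exact: addr_ge0 a0 (ltW wy).
    rewrite semi_pos ?w_pos // semitrough_sqr.
    by have := sqr_ge0 (w y); nra.
  have [x1pos|x1neg] := leP 0 (x1 x).
    have nx : enorm x <= (2 * w y)^-1.
      apply: key; [exact: enorm_ge0|exact: enorm_le_V|].
      by rewrite enorm_split addrA lerD2r; move: gb; rewrite max_l.
    apply: coord_bound; last exact: le_trans (enorm_xbar_le x) nx.
    have := normr_coord_le_enorm x ord0; rewrite -/(x1 x).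
    by lra.
  apply: coord_bound.
    by rewrite ltr0_norm //; lra.
  apply: key; [exact: enorm_ge0|exact: enorm_xbar_le_V|].
  by rewrite lerD2r; move: gb; rewrite max_r ?(ltW x1neg) // expr0n addr0.
have gx0 : 0 < perturbed f e (x1 x0).
  by apply: w_pos; apply: lt_le_trans (x0max y).
have N1 : - 1 != 0 :> R by rewrite oppr_eq0 oner_neq0.
have [|defect] := contact_curvature u_smooth N1
   (perturbed_derive hf l0) (perturbed1_derive hf l0 (x1 x0)) gx0 _
   u_spacelike (u_sigma1 x0).
  move=> d; have := line_gt0_near (x1 d) (perturbed_derive hf l0) gx0.
  apply: filterS => t gt; rewrite !mulN1r !opprB.
  have := x0max (x0 + t *: d); rewrite /w !semi_pos //.
  by rewrite x1D x1Z.
rewrite mulN1r oppr_le0 subr_ge0 leNgt => /negP; apply.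
exact: perturbed_subsolution.
Qed.

Lemma semitrough_perturbed_continuous x :
  {for (0 : R), continuous (fun e => semitrough (perturbed f e) x)}.
Proof.
have pc := perturbed_continuous (t := x1 x) hf.
apply: continuous_comp; last exact: sqrt_continuous.
apply: (@continuousD _ _ _ (fun e => perturbed f e (x1 x) ^+ 2)).
  exact: (continuousM pc pc).
exact: cst_continuous.
Qed.

(** A strict inequality at [x] would persist for small [e] by continuity in [e], against the
    comparison with the perturbed semitrough of the corresponding sign. *)
Lemma eq_semitrough x : u x = semitrough f x.
Proof.
have E0 : semitrough (perturbed f 0) x = semitrough f x.
  by rewrite /semitrough perturbed0.
have Fc := semitrough_perturbed_continuous (x := x).
apply/eqP; rewrite eq_le; apply/andP; split; rewrite leNgt; apply/negP => lt_x.
  have : \forall e \near (0 : R), semitrough (perturbed f e) x < u x.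
    by apply: cvgr_lt Fc _ _; rewrite E0.
  move=> /nbhs_ballP [r /= r0 near0].
  (* Inside the ball of radius [r] and within the range allowed by the comparison. *)
  pose e := Num.min (r / 2) 64^-1.
  have e0 : 0 < e by rewrite lt_min divr_gt0 //= invr_gt0 ltr0n.
  have : semitrough (perturbed f e) x < u x.
    apply: near0; rewrite -ball_normE /= sub0r normrN gtr0_norm //.
    by rewrite (@le_lt_trans _ _ (r / 2)) ?ge_min ?lexx //; lra.
  rewrite ltNge => /negP; apply; apply: u_le_perturbed.
  by rewrite e0 ge_min lexx orbT.
have : \forall e \near (0 : R), u x < semitrough (perturbed f e) x /\
    0 < perturbed f e (x1 x).
  have g0 : \forall e \near (0 : R), 0 < perturbed f e (x1 x).
    apply: cvgr_gt (perturbed_continuous (t := x1 x) hf) _ _.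
    by rewrite perturbed0; exact: profile_gt0 hf _.
  have F0 : \forall e \near (0 : R), u x < semitrough (perturbed f e) x.
    by apply: cvgr_gt Fc _ _; rewrite E0.
  by apply: filterS2 F0 g0.
move=> /nbhs_ballP [r /= r0 near0].
pose e := Num.min (r / 2) 64^-1.
have e0 : 0 < e by rewrite lt_min divr_gt0 //= invr_gt0 ltr0n.
have [] : u x < semitrough (perturbed f (- e)) x /\
    0 < perturbed f (- e) (x1 x).
  apply: near0; rewrite -ball_normE /= sub0r opprK gtr0_norm //.
  by rewrite (@le_lt_trans _ _ (r / 2)) ?ge_min ?lexx //; lra.
rewrite ltNge => /negP + g0; apply; apply: perturbed_le_u => //.
by rewrite opprK e0 ge_min lexx orbT.
Qed.

End Comparison.
End GlobalComparison.

Theorem theorem2 (R : realType) (m : nat) (hm : (2 <= m.+1)%N)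
  (f1 : R -> R) (hf1 : semitrough_profile m.+1 f1)
  (u : 'rV[R]_m.+1 -> R) (u_smooth : smooth u) (u_spacelike : spacelike u)
  (u_sigma1 : forall x, exists kappa,
     principal_curvatures u x kappa /\ sigma1 kappa = m.+1%:R)
  (u_lim_half_sphere : forall e : R, 0 < e -> exists M : R,
     forall x, M < enorm x -> half_sphere ((enorm x)^-1 *: x) ->
       `|u x - V_half_sphere x| < e)
  (u_lim_flat : forall e : R, 0 < e -> exists M : R,
     forall x, x1 x < - M -> M < enorm (xbar x) ->
       `|u x - V_half_sphere x| < e)
  (u_bounded : exists C0 : R, forall x, `|u x - V_half_sphere x| <= C0) :
  forall x, u x = semitrough f1 x.
Proof.
apply: eq_semitrough => //.
- by move=> x; exact: V_le_spacelike.
- by move=> e e0; exact: spacelike_le_V_far.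
Qed.
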